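(* For all integers $d\geq1$, $1\leq m\leq d$ and $k\geq2$, where $k\geq3$ when $d=1$, and for every $0<\epsilon<1/8$, one has \[ d\left(1-\frac{\log32}{\log(4/\epsilon)}\right)+\frac{\log\left(r_{k,m}(\lceil1/(8\epsilon)\rceil)/\lceil1/(8\epsilon)\rceil^m\right)}{\log(4/\epsilon)}\leq D_{\mathrm{S}}(k,\epsilon,d,m)\leq D_{\mathrm{A}}(k,\epsilon,d,m) \] and \[ D_{\mathrm{A}}(k,\epsilon,d,m)\leq d+\frac{1}{2}\,\frac{\log\left(r_{k,m}(\lceil\sqrt{d}/\epsilon\rceil)/\lceil\sqrt{d}/\epsilon\rceil^m\right)}{\log\lceil\sqrt{d}/\epsilon\rceil}. \]
   Context: Let $\mathbf{v}=\{v_1,\ldots,v_m\}$ be a set of $m$ pairwise orthogonal unit vectors in $\mathbb{R}^d$, $1\le m\le d$. For a positive integer $k$ and $\Delta>0$, a set $P\subset\mathbb{R}^d$ is an arithmetic patch of size $k$ and scale $\Delta$ with orientation $\mathbf{v}$ if $P=\{t+\Delta\sum_{i=1}^m x_iv_i : x_i=0,1,\ldots,k-1\}$ for some $t\in\mathbb{R}^d$. For $\epsilon\in[0,1/2)$, a set $Q\subset\mathbb{R}^d$ is a $(k,\epsilon,\mathbf{v})$-AP if there is an arithmetic patch $P$ of size $k$ and some scale $\Delta>0$ with orientation $\mathbf{v}$ such that $\sup_{x\in P}\inf_{y\in Q}\|x-y\|\leq\epsilon\Delta$ (Euclidean norm). A set contains a $(k,\epsilon,\mathbf{v})$-AP if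 some subset of it is one. $e_i$ denotes the $i$-th standard basis vector. $r_{k,m}(N)$ is the largest cardinality of a set $A\subseteq\{1,\ldots,N\}^m$ that does not contain any arithmetic patch of size $k$ (any scale $\Delta>0$) with orientation $\{e_1,\ldots,e_m\}$, the standard basis of $\mathbb{R}^m$. The Assouad dimension of $F\subseteq\mathbb{R}^d$ is $\dim_{\mathrm{A}}F=\inf\{\sigma\geq0 : \exists C>0\ \forall r>0\ \forall R>r\ \forall x\in F,\ N(B(x,R)\cap F,r)\leq C(R/r)^\sigma\}$, where $B(x,R)$ is the closed ball of radius $R$ centred at $x$ and $N(E,r)$ is the smallest cardinality of a family of sets of diameter at most $r$ covering $E$. $\dim_{\mathrm{H}}$ is the Hausdorff dimension. $D_{\mathrm{A}}(k,\epsilon,d,m)=\sup\{\dim_{\mathrm{A}}F : F\subseteq\mathbb{R}^d$ does not contain any $(k,\epsilon,\mathbf{v})$-APs for some set of orthogonal unit vectors $\mathbf{v}=\{v_1,\ldots,v_m\}\}$. $D_{\mathrm{S}}(k,\epsilon,d,m)=\sup\{\dim_{\mathrm{H}}F\}$, the supremum over all compact $F\subset\mathbb{R}^d$ such that $F$ is the attractor (the nonempty compact set with $F=\bigcup_{i=1}^n f_i(F)$) of a finite iterated function system $\{f_1,\ldots,f_n\}$ of contracting similarities of $\mathbb{R}^d$ satisfying the open set condition (there is a nonempty bounded open $V\subset\mathbb{R}^d$ with $V\supseteq\bigcup_{i=1}^n f_i(V)$, the union being pairwise disjoint), and $F$ does not contain any $(k,\epsilon,\{e_1,\ldots,e_m\})$-APs.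 *)

(* Defs.v *)
From HB Require Import structures.
From mathcomp Require Import all_boot all_order all_algebra.
From mathcomp Require Import all_classical all_reals all_analysis.
Import Order.TTheory GRing.Theory Num.Theory.
Import numFieldNormedType.Exports.

Set Implicit Arguments.
Unset Strict Implicit.
Unset Printing Implicit Defensive.

Local Open Scope classical_set_scope.
Local Open Scope ring_scope.

(* R^d is 'rV[R]_d.  The library norm on matrices is the sup norm, so the
   Euclidean norm is defined here; both induce the same topology, hence
   [open], [compact] and [bounded_set] are the library notions. *)
Definition dotp (R : realType) (d : nat) (x y : 'rV[R]_d) : R :=
  \sum_(i < d) x ord0 i * y ord0 i.

Definition enorm (R : realType) (d : nat) (x : 'rV[R]_d) : R :=
  Num.sqrt (dotp x x).

Definition ecball (R : realType) (d : nat) (x : 'rV[R]_d) (r : R) :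
  set 'rV[R]_d := [set y | enorm (x - y) <= r].

(* The maximum with 0 makes the diameter of the empty set equal to 0. *)
Definition diam (R : realType) (d : nat) (U : set 'rV[R]_d) : \bar R :=
  Order.max 0%E
    (ereal_sup [set (enorm (p.1 - p.2))%:E | p in U `*` U]).

Definition orthonormal_family (R : realType) (d m : nat)
    (v : 'I_m -> 'rV[R]_d) : Prop :=
  (forall i, enorm (v i) = 1) /\ (forall i j, i != j -> dotp (v i) (v j) = 0).

(* e_1, ..., e_m in R^d, indexed from 0; meant for m <= d. *)
Definition std_basis (R : realType) (d m : nat) (i : 'I_m) : 'rV[R]_d :=
  \row_(j < d) (val j == val i)%:R.

Definition is_patch (R : realType) (d m : nat) (k : nat) (Delta : R)
    (v : 'I_m -> 'rV[R]_d) (P : set 'rV[R]_d) : Prop :=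
  exists t : 'rV[R]_d,
    P = [set t + Delta *: (\sum_(i < m) (x i)%:R *: v i)
        | x in [set: 'I_m -> 'I_k]].

(* Infimum and supremum are taken in the extended reals, so that the infimum
   over an empty Q is +oo. *)
Definition is_AP (R : realType) (d m : nat) (k : nat) (eps : R)
    (v : 'I_m -> 'rV[R]_d) (Q : set 'rV[R]_d) : Prop :=
  exists (Delta : R) (P : set 'rV[R]_d),
    [/\ 0 < Delta, is_patch k Delta v P &
      (ereal_sup [set ereal_inf [set (enorm (x - y))%:E | y in Q] | x in P]
         <= (eps * Delta)%:E)%E].

Definition contains_AP (R : realType) (d m : nat) (k : nat) (eps : R)
    (v : 'I_m -> 'rV[R]_d) (F : set 'rV[R]_d) : Prop :=
  exists Q : set 'rV[R]_d, Q `<=` F /\ is_AP k eps v Q.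

(* {1, ..., N}^m is the type {ffun 'I_m -> 'I_N}, embedded in R^m by shifting
   every coordinate by one. *)
Definition grid_point (R : realType) (m N : nat) (x : {ffun 'I_m -> 'I_N}) :
  'rV[R]_m := \row_(i < m) (x i).+1%:R.

Definition contains_patch (R : realType) (k m N : nat)
    (A : {set {ffun 'I_m -> 'I_N}}) : Prop :=
  exists (Delta : R) (P : set 'rV[R]_m),
    [/\ 0 < Delta, is_patch k Delta (@std_basis R m m) P &
      P `<=` @grid_point R m N @` [set` A]].

Definition max_patch_free (R : realType) (k m N : nat) : nat :=
  \max_(A : {set {ffun 'I_m -> 'I_N}} | `[< ~ contains_patch R k A >]) #|A|.

(* +oo when no finite cover exists. *)
Definition covering_number (R : realType) (d : nat) (E : set 'rV[R]_d)
    (r : R) : \bar R :=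
  ereal_inf [set (n%:R)%:E | n in [set n : nat |
    exists U : 'I_n -> set 'rV[R]_d,
      (forall i, (diam (U i) <= r%:E)%E) /\ E `<=` \bigcup_i U i]].

Definition assouad_dim (R : realType) (d : nat) (F : set 'rV[R]_d) : \bar R :=
  ereal_inf [set s%:E | s in [set s : R | 0 <= s /\
    exists C : R, 0 < C /\
      forall r : R, 0 < r -> forall rho : R, r < rho -> forall x, F x ->
        (covering_number (ecball x rho `&` F) r
           <= (C * (rho / r) `^ s)%:E)%E]].

(* |U|^s, with the usual convention that it is 0 for U empty, also if s = 0. *)
Definition diam_pow (R : realType) (d : nat) (s : R) (U : set 'rV[R]_d) :
  \bar R := if `[< U = set0 >] then 0%E else (diam U `^ s)%E.

Definition hausdorff_premeasure (R : realType) (d : nat) (s delta : R)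
    (F : set 'rV[R]_d) : \bar R :=
  ereal_inf [set (\sum_(0 <= i <oo) diam_pow s (U i))%E
    | U in [set U : nat -> set 'rV[R]_d |
        (forall i, (diam (U i) <= delta%:E)%E) /\ F `<=` \bigcup_i U i]].

(* The premeasure is nonincreasing in delta, so the limit as delta -> 0 is a
   supremum. *)
Definition hausdorff_measure (R : realType) (d : nat) (s : R)
    (F : set 'rV[R]_d) : \bar R :=
  ereal_sup [set hausdorff_premeasure s delta F
    | delta in [set delta : R | 0 < delta]].

Definition hausdorff_dim (R : realType) (d : nat) (F : set 'rV[R]_d) : \bar R :=
  ereal_inf [set s%:E | s in [set s : R |
    0 <= s /\ hausdorff_measure s F = 0%E]].

Definition contracting_similarity (R : realType) (d : nat)
    (f : 'rV[R]_d -> 'rV[R]_d) : Prop :=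
  exists c : R, 0 < c < 1 /\
    forall x y, enorm (f x - f y) = c * enorm (x - y).

Definition open_set_condition (R : realType) (d n : nat)
    (f : 'I_n -> 'rV[R]_d -> 'rV[R]_d) : Prop :=
  exists V : set 'rV[R]_d,
    [/\ V !=set0, bounded_set V, open V,
        \bigcup_i (f i @` V) `<=` V & trivIset setT (fun i => f i @` V)].

Definition is_attractor (R : realType) (d n : nat)
    (f : 'I_n -> 'rV[R]_d -> 'rV[R]_d) (F : set 'rV[R]_d) : Prop :=
  [/\ F !=set0, compact F & F = \bigcup_i (f i @` F)].

Definition self_similar_OSC (R : realType) (d : nat) (F : set 'rV[R]_d) :
    Prop :=
  exists (n : nat) (f : 'I_n -> 'rV[R]_d -> 'rV[R]_d),
    [/\ forall i, contracting_similarity (f i), open_set_condition f &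
        is_attractor f F].

Definition D_A (R : realType) (k : nat) (eps : R) (d m : nat) : \bar R :=
  ereal_sup [set assouad_dim F | F in [set F : set 'rV[R]_d |
    exists v : 'I_m -> 'rV[R]_d,
      orthonormal_family v /\ ~ contains_AP k eps v F]].

Definition D_S (R : realType) (k : nat) (eps : R) (d m : nat) : \bar R :=
  ereal_sup [set hausdorff_dim F | F in [set F : set 'rV[R]_d |
    self_similar_OSC F /\ ~ contains_AP k eps (@std_basis R d m) F]].

(* The ceiling as a natural number; used only for positive arguments. *)
Definition nat_ceil (R : realType) (x : R) : nat := `|Num.ceil x|%N.

(* Main.v *)
(* Lower bound: fix a patch-free set A of maximal size in {1, ..., N}^m with
   N = ceil(1/(8 eps)), and let F be the self-similar set of the homotheties of
   ratio eps/4 whose translations lie on a grid of mesh 7 eps, indexed by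
   A x {1, ..., N}^(d-m).  First-level pieces are much smaller than the mesh, so
   rounding an approximate patch in F to the indices of its pieces gives an exact
   patch in A, unless all its points lie in one piece; but then it can be blown up
   by 4/eps inside F, which cannot be repeated forever in a bounded set.  The
   pieces are separated, so dim_H F = ln (|A| N^(d-m)) / ln (4/eps).

   Upper bound: cut a cube, with sides along an orthonormal basis extending v, into
   N^(2d) cells, where now N = ceil(sqrt d / eps), and write the first m
   coordinates of the index of a cell as N u + p with 0 <= u, p < N.  When p and
   the last d - m coordinates are fixed, the scale of an exact patch among the u
   of the cells that meet F is at least N cell sides, and the cells have diameter
   at most eps times this, so that F contains an approximate patch.
   Hence at most r_{k,m}(N) N^(2d-m) cells meet F, and this is iterated. *)

Require Import Defs.
From mathcomp Require Import all_boot all_order all_algebra.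
From mathcomp Require Import all_classical all_reals all_analysis.
From mathcomp Require Import ring lra zify.
Import Order.TTheory GRing.Theory Num.Theory.
Import numFieldNormedType.Exports.

Set Implicit Arguments.
Unset Strict Implicit.
Unset Printing Implicit Defensive.

Local Open Scope classical_set_scope.
Local Open Scope ring_scope.

(** * Euclidean norm and diameter *)

Lemma dotp_ge0 (R : realType) d (x : 'rV[R]_d) : 0 <= dotp x x.
Proof. by apply: sumr_ge0 => i _; rewrite -expr2 sqr_ge0. Qed.

Lemma enorm_ge0 (R : realType) d (x : 'rV[R]_d) : 0 <= enorm x.
Proof. exact: sqrtr_ge0. Qed.

Lemma coord_le_enorm (R : realType) d (x : 'rV[R]_d) j :
  `|x ord0 j| <= enorm x.
Proof.
rewrite /enorm -[`|_|]ger0_norm // -sqrtr_sqr ler_wsqrtr //.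
rewrite real_normK ?num_real // /dotp (bigD1 j) //= -expr2 lerDl.
by apply: sumr_ge0 => i _; rewrite -expr2 sqr_ge0.
Qed.

Lemma enorm_le (R : realType) d (x : 'rV[R]_d) b :
  (forall j, `|x ord0 j| <= b) -> enorm x <= Num.sqrt d%:R * b.
Proof.
case: d x => [|d] x hx.
  by rewrite /enorm /dotp big_ord0 sqrtr0 mul0r.
have b0 : 0 <= b by apply: le_trans (hx ord0).
rewrite -[b in leRHS]ger0_norm // -sqrtr_sqr -sqrtrM ?ler0n //.
apply: ler_wsqrtr; rewrite /dotp -[d.+1 in leRHS]card_ord mulr_natl -sumr_const.
apply: ler_sum => j _; rewrite -expr2 -real_normK ?num_real //.
by rewrite lerXn2r ?nnegrE.
Qed.

Lemma enormZ (R : realType) d (a : R) (x : 'rV[R]_d) :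
  enorm (a *: x) = `|a| * enorm x.
Proof.
rewrite /enorm -sqrtr_sqr -sqrtrM ?sqr_ge0 //; congr Num.sqrt.
by rewrite /dotp big_distrr /=; apply: eq_bigr => i _; rewrite !mxE; ring.
Qed.

Lemma sum_natr_eq (R : realType) m (c : 'I_m -> R) (j : nat) (hj : (j < m)%N) :
  \sum_(i < m) c i * (j == i)%:R = c (Ordinal hj).
Proof.
rewrite (bigD1 (Ordinal hj)) //= eqxx mulr1 big1 ?addr0 // => i ij.
suff /negbTE-> : j != i by rewrite mulr0.
by apply: contraNneq ij => ji; apply/eqP/val_inj.
Qed.

Lemma std_basis_sum (R : realType) d m (c : 'I_m -> R) (j : 'I_d) :
  (\sum_(i < m) c i *: @std_basis R d m i) ord0 j =
  if insub (val j) is Some i then c i else 0.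
Proof.
rewrite summxE; under eq_bigr do rewrite !mxE.
case: insubP => [i hj ij|jm].
  by rewrite (sum_natr_eq _ hj); congr c; apply/val_inj.
rewrite big1 // => i _; suff /negbTE-> : val j != val i by rewrite mulr0.
by apply: contraNneq jm => ->; exact: ltn_ord.
Qed.

Lemma std_basis_orthonormal (R : realType) d m : (m <= d)%N ->
  orthonormal_family (@std_basis R d m).
Proof.
move=> md; have dotE i i' : dotp (@std_basis R d m i) (std_basis R d i') = (i == i')%:R.
  rewrite /dotp; under eq_bigr do rewrite !mxE.
  rewrite (bigD1 (widen_ord md i)) //= eqxx mul1r val_eqE big1 ?addr0 // => j ji.
  suff /negbTE-> : val j != val i by rewrite mul0r.
  by apply: contraNneq ji => e; apply/eqP/val_inj.
split=> [i|i i' ii']; first by rewrite /enorm dotE eqxx sqrtr1.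
by rewrite dotE (negbTE ii').
Qed.

Lemma diam_le (R : realType) d (U : set 'rV[R]_d) b : 0 <= b ->
  (forall x y, U x -> U y -> enorm (x - y) <= b) -> (diam U <= b%:E)%E.
Proof.
move=> b0 h; rewrite /diam ge_max lee_fin b0 /=.
by apply: ge_ereal_sup => _ [[x y] [/= Ux Uy] <-]; rewrite lee_fin h.
Qed.

Lemma enorm_le_diam (R : realType) d (U : set 'rV[R]_d) x y : U x -> U y ->
  ((enorm (x - y))%:E <= diam U)%E.
Proof.
move=> Ux Uy; rewrite /diam le_max; apply/orP; right.
by apply: ereal_sup_ubound; exists (x, y).
Qed.

Lemma diam_ge0 (R : realType) d (U : set 'rV[R]_d) : (0 <= diam U)%E.
Proof. by rewrite /diam le_max lexx. Qed.

Lemma diam_set0 (R : realType) d : diam (@set0 'rV[R]_d) = 0%E.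
Proof. by apply/eqP; rewrite eq_le diam_ge0 diam_le. Qed.

(** * Hausdorff and Assouad dimension *)

Lemma diam_pow_ge0 (R : realType) d s (U : set 'rV[R]_d) : (0 <= diam_pow s U)%E.
Proof. by rewrite /diam_pow; case: ifP => // _; exact: poweR_ge0. Qed.

Lemma diam_pow_le (R : realType) d s r (U : set 'rV[R]_d) : 0 <= s ->
  (diam U <= r%:E)%E -> (diam_pow s U <= (r `^ s)%:E)%E.
Proof.
move=> s0 Ur; have r0 : 0 <= r by rewrite -lee_fin (le_trans (diam_ge0 U)).
rewrite /diam_pow; case: ifP => _; first by rewrite lee_fin powR_ge0.
rewrite -poweR_EFin; apply: gt0_ler_poweR => //; rewrite in_itv /= leey andbT //.
exact: diam_ge0.
Qed.

Lemma hausdorff_premeasure_ge0 (R : realType) d s delta (F : set 'rV[R]_d) :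
  (0 <= hausdorff_premeasure s delta F)%E.
Proof.
apply: le_ereal_inf_tmp => _ [U _ <-].
by apply: nneseries_ge0 => n _ _; exact: diam_pow_ge0.
Qed.

(** The finite cover is continued by empty sets, to which [diam_pow] gives the value 0 even for s =
    0. *)
Lemma hausdorff_premeasure_le_cover (R : realType) d s delta r n
    (U : 'I_n -> set 'rV[R]_d) (F : set 'rV[R]_d) : 0 <= s -> 0 <= r -> r <= delta ->
  (forall i, (diam (U i) <= r%:E)%E) -> F `<=` \bigcup_i U i ->
  (hausdorff_premeasure s delta F <= (n%:R * r `^ s)%:E)%E.
Proof.
move=> s0 r0 rdelta Ur FU.
pose V i := if insub i is Some j then U j else set0.
have Vr i : (diam (V i) <= r%:E)%E.
  by rewrite /V; case: insubP => // _; rewrite diam_set0 lee_fin.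
apply: (@le_trans _ _ (\sum_(0 <= i <oo) diam_pow s (V i))%E).
  apply: ereal_inf_lbound; exists V => //; split.
    by move=> i; rewrite (le_trans (Vr i)).
  move=> x /FU[i _ Uix]; exists (val i) => //.
  by rewrite /V; case: insubP => [j _ /val_inj-> //|]; rewrite ltn_ord.
rewrite (nneseries_split 0 n); last by move=> *; exact: diam_pow_ge0.
rewrite [X in (_ + X)%E]eseries0 => [|i]; last first.
  rewrite add0n => ni _; rewrite /V; case: insubP => [j|_]; first by rewrite ltnNge ni.
  by rewrite /diam_pow asboolT.
rewrite adde0 add0n big_mkord mulr_natl -[n in (_ *+ n)]card_ord -sumr_const -sumEFin.
by apply: lee_sum => i _; exact: diam_pow_le.
Qed.

(** A bounded F lies in one ball of fixed radius rho about any of its points. If s is admissible for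
    the Assouad dimension, F is thus covered by O(r^-s) sets of diameter r, and its premeasure of
    exponent s + e is O(r^e), which tends to 0 with r. *)
Lemma hausdorff_le_assouad (R : realType) d (F : set 'rV[R]_d) b :
  (forall x, F x -> forall j, `|x ord0 j| <= b) ->
  (hausdorff_dim F <= assouad_dim F)%E.
Proof.
move=> Fb; apply: le_ereal_inf_tmp => _ [s [s0 [C [C0 hC]]] <-].
apply/lee_addgt0Pr => e e0; apply: ereal_inf_lbound; exists (s + e) => //.
split; first by rewrite addr_ge0 // ltW.
have se0 : 0 <= s + e by rewrite addr_ge0 // ltW.
apply/eqP; rewrite eq_le; apply/andP; split; last first.
  apply: (@le_trans _ _ (hausdorff_premeasure (s + e) 1 F)).
    exact: hausdorff_premeasure_ge0.
  by apply: ereal_sup_ubound; exists 1 => //=.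
apply: ge_ereal_sup => _ [delta /= delta0 <-].
(* The Assouad bound needs a centre in F; the empty set is covered by zero sets. *)
have [->|/set0P[x Fx]] := eqVneq F set0.
  rewrite -[leRHS]/0%:E -(mul0r (0 `^ (s + e))).
  by apply: (@hausdorff_premeasure_le_cover _ _ _ _ _ 0 (fun=> set0)) => //; [exact: ltW|case].
have b0 : 0 <= `|b| by [].
pose rho := Num.sqrt d%:R * (2 * `|b|) + 1.
have rho1 : 1 <= rho by rewrite lerDr mulr_ge0 ?sqrtr_ge0 ?mulr_ge0.
have FB : ecball x rho `&` F = F.
  apply/seteqP; split=> [y []//|y Fy]; split=> //; rewrite /ecball /=.
  apply: (@le_trans _ _ (Num.sqrt d%:R * (2 * `|b|))); last by rewrite lerDl.
  apply: enorm_le => j; rewrite !mxE mulr_natl mulr2n.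
  by rewrite (le_trans (ler_normB _ _)) // lerD // (le_trans (Fb _ _ j)) // ler_norm.
apply/lee_addgt0Pr => eta eta0; rewrite add0e.
(* The radius r is chosen so that K r^e <= eta, while r <= 1/2 gives both r < rho and r^s <= 1. *)
pose K := C * rho `^ s + 1.
have K0 : 0 < K by rewrite addr_gt0 // mulr_gt0 // powR_gt0 // (lt_le_trans _ rho1).
pose r := Num.min (Num.min delta (1 / 2)) ((eta / K) `^ e^-1).
have etaK : 0 < eta / K by rewrite divr_gt0.
have r0 : 0 < r by rewrite !lt_min delta0 powR_gt0 // divr_gt0.
have rdelta : r <= delta by rewrite !ge_min lexx.
have r1 : r <= 1 / 2 by rewrite !ge_min lexx orbT.
have reta : r `^ e <= eta / K.
  rewrite -[leRHS]powRr1 ?(ltW etaK) // -(mulVf (lt0r_neq0 e0)) powRrM.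
  apply: ge0_ler_powR; rewrite ?nnegrE ?powR_ge0 ?(ltW e0) ?(ltW r0) //.
  by rewrite /r ge_min lexx orbT.
have rrho : r < rho by apply: le_lt_trans r1 _; lra.
have := hC r r0 rho rrho x Fx; rewrite FB => hcov.
(* The summand 1 makes the inequality strict, so that an actual cover can be taken from the infimum;
   it is absorbed in K because r^s <= 1. *)
have : (covering_number F r < (C * (rho / r) `^ s + 1)%:E)%E.
  by apply: le_lt_trans hcov _; rewrite lte_fin ltrDl.
move=> /ereal_inf_ltP[_ [n [U [Ur FU]] <-]]; rewrite lte_fin => hn.
apply: le_trans (hausdorff_premeasure_le_cover se0 (ltW r0) rdelta Ur FU) _.
rewrite lee_fin.
apply: (@le_trans _ _ ((C * (rho / r) `^ s + 1) * r `^ (s + e))).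
  by rewrite ler_wpM2r ?powR_ge0 // ltW.
have rhor : rho = rho / r * r by rewrite divfK // gt_eqF.
have rsD : r `^ (s + e) = r `^ s * r `^ e by rewrite powRD ?(gt_eqF r0) ?implybT.
have h1 : (rho / r) `^ s * r `^ s = rho `^ s.
  rewrite -powRM -?rhor // ?(ltW r0) // divr_ge0 ?ltW //; lra.
have rs1 : r `^ s <= 1.
  by rewrite -(powRr0 r) ger_powR // r0 /=; lra.
have : K * r `^ e <= eta by rewrite mulrC -ler_pdivlMr.
apply: le_trans; rewrite rsD mulrDl mul1r mulrA -(mulrA C) h1 /K mulrDl mul1r lerD2l.
by rewrite ler_piMl ?powR_ge0.
Qed.

(** * Self-similar sets of homotheties *)

Lemma exists_expr_lt (R : realType) (q e : R) : 0 <= q -> q < 1 -> 0 < e ->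
  exists l, q ^+ l < e.
Proof.
move=> q0 q1 e0.
have /cvgrPdist_lt/(_ e e0)[l _ /(_ l (leqnn l))] :
  (fun l => q ^+ l) @ \oo --> (0 : R).
  by apply: cvg_expr; rewrite ger0_norm.
by rewrite /= sub0r normrN ger0_norm ?exprn_ge0 // => h; exists l.
Qed.

Lemma exists_scale (R : realType) (q D : R) : 0 < q -> q < 1 -> 0 < D -> D < 1 ->
  exists l, q ^+ l.+1 <= D < q ^+ l.
Proof.
move=> q0 q1 D0 D1; have /exists_expr_lt/(_ q1 D0)[l hl] := ltW q0.
have ex : exists l, q ^+ l <= D by exists l; exact: ltW.
case: (ex_minnP ex) => -[|l' hl' min]; first by rewrite expr0 leNgt D1.
exists l'; rewrite hl' ltNge /=; apply/negP => /min; by rewrite ltnn.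
Qed.

Lemma card_prefix (I : finType) (L : nat) (p : seq I) : (size p <= L)%N ->
  (#|[pred w : L.-tuple I | take (size p) w == p]| <= #|I| ^ (L - size p))%N.
Proof.
move=> pL; rewrite -card_tuple.
apply: (@leq_card_in _ _ (fun w : L.-tuple I => [tuple of drop (size p) w])).
move=> w w' /[!inE] /eqP wp /eqP w'p /(congr1 val) /= e; apply/val_inj => /=.
by rewrite -[LHS](cat_take_drop (size p)) -[RHS](cat_take_drop (size p)) wp w'p e.
Qed.

(** Each p i is a prefix of at most #|I|^(L - |p i|) words of length L, and together these exhaust
    all #|I|^L words; divide by #|I|^L. *)
Lemma kraft_cover (R : realType) (I : finType) (K L : nat) (p : 'I_K -> seq I) :
  (0 < #|I|)%N -> (forall i, size (p i) <= L)%N ->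
  (forall w : L.-tuple I, exists i, take (size (p i)) w = p i) ->
  1 <= \sum_(i < K) (#|I|%:R^-1 : R) ^+ size (p i).
Proof.
move=> I0 pL cov; have n0 : 0 < #|I|%:R :> R by rewrite ltr0n.
have : (#|{: L.-tuple I}| <= \sum_(i < K) #|I| ^ (L - size (p i)))%N.
  apply: (@leq_trans (\sum_w \sum_(i < K) (take (size (p i)) (w : L.-tuple I) == p i))).
    rewrite -sum1_card; apply: leq_sum => w _; have [i wi] := cov w.
    by rewrite (bigD1 i) //= wi eqxx.
  rewrite exchange_big; apply: leq_sum => i _; apply: leq_trans (card_prefix (pL i)).
  by rewrite -sum1_card [leqRHS]big_mkcond; apply: leq_sum => w _; rewrite inE; case: eqP.
rewrite card_tuple -(ler_nat R) natr_sum natrX.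
rewrite -[leLHS]mul1r -ler_pdivlMr ?exprn_gt0 // mulr_suml => /le_trans; apply.
apply: ler_sum => i _; rewrite natrX exprVn -[in leLHS](subnK (pL i)) exprD invfM.
by rewrite mulrA addnK mulfV ?mul1r // gt_eqF ?exprn_gt0.
Qed.

Section HomothetyIFS.
Variables (R : realType) (d : nat) (I : finType) (rho : R) (tau : I -> 'rV[R]_d).

Definition unit_cube : set 'rV[R]_d := [set x | forall j, 0 <= x ord0 j <= 1].

Definition homothety (i : I) (x : 'rV[R]_d) : 'rV[R]_d := tau i + rho *: x.

Definition homothety_inv (i : I) (x : 'rV[R]_d) : 'rV[R]_d :=
  rho^-1 *: (x - tau i).

(** For rho > 0 this is the union of the images of the unit cube under all compositions of L
    homotheties. Preimages under the inverse maps are used so that closedness follows from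
    continuity. *)
Fixpoint ifs_level (L : nat) : set 'rV[R]_d :=
  if L is L'.+1 then \bigcup_i (homothety_inv i @^-1` ifs_level L')
  else unit_cube.

Definition ifs_limit : set 'rV[R]_d := \bigcap_L ifs_level L.

Hypothesis rho_gt0 : 0 < rho.
Hypothesis tau_cube : forall i j, 0 <= tau i ord0 j <= 1 - rho.

Lemma homothetyK i : cancel (homothety i) (homothety_inv i).
Proof.
by move=> x; rewrite /homothety /homothety_inv addrC addKr scalerA mulVf
  ?scale1r ?gt_eqF.
Qed.

Lemma homothety_invK i : cancel (homothety_inv i) (homothety i).
Proof.
by move=> x; rewrite /homothety /homothety_inv scalerA mulfV ?gt_eqF // scale1r
  addrC subrK.
Qed.

Lemma ifs_level_decr L : ifs_level L.+1 `<=` ifs_level L.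
Proof.
elim: L => [|L IH] x [i _ /=]; last by move=> /IH; exists i.
move=> hx j; rewrite -(homothety_invK i x) !mxE.
have /andP[t0 t1] := tau_cube i j; have /andP[y0 y1] := hx j.
rewrite !mxE in y0 y1; move: (rho^-1 * _) y0 y1 => y y0 y1.
have ? : 0 <= rho * y by rewrite mulr_ge0 // ltW.
have ? : rho * y <= rho by rewrite ler_piMr // ltW.
by apply/andP; split; lra.
Qed.

Lemma ifs_level_homo L M : (L <= M)%N -> ifs_level M `<=` ifs_level L.
Proof.
elim: M => [|M IH]; first by rewrite leqn0 => /eqP->.
rewrite leq_eqVlt => /orP[/eqP->//|]; rewrite ltnS => /IH h x /ifs_level_decr.
exact: h.
Qed.

Lemma ifs_limit_cube : ifs_limit `<=` unit_cube.
Proof. by move=> x /(_ 0%N); exact. Qed.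

Lemma ifs_limit_homothety i x : ifs_limit x -> ifs_limit (homothety i x).
Proof.
move=> hx L _; apply: ifs_level_decr; exists i => //=; rewrite homothetyK.
exact: hx.
Qed.

Lemma ifs_limit_inv x : ifs_limit x -> exists i, ifs_limit (homothety_inv i x).
Proof.
move=> hx; apply: contrapT => /forallNP h.
(* If x had no preimage in the limit set, each of the finitely many preimages would leave at some
   level; as the levels decrease, x itself would leave one level after the largest of these. *)
have bad i : exists L, ~ ifs_level L (homothety_inv i x).
  apply: contrapT => /forallNP hL; apply: (h i) => L _; exact: contrapT.
pose f i := sval (cid (bad i)).
have [i _] := hx (\max_i f i).+1 Logic.I.
move=> /(@ifs_level_homo (f i) _ (leq_bigmax i)).
by rewrite /f; case: cid.
Qed.

Lemma ifs_limitE : ifs_limit = \bigcup_i (homothety i @` ifs_limit).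
Proof.
apply/seteqP; split=> [x /ifs_limit_inv[i hi]|x [i _ [y hy <-]]].
  exists i => //; exists (homothety_inv i x) => //; exact: homothety_invK.
exact: ifs_limit_homothety.
Qed.

Lemma homothety_inv_continuous i : continuous (homothety_inv i).
Proof.
move=> x; apply: (@cvgZl_tmp _ 'rV[R]_d _ (nbhs x) _ _ (fun y => y - tau i)).
apply: (@cvgB _ 'rV[R]_d _ (nbhs x) _ id (fun=> tau i)); first exact: cvg_id.
exact: cvg_cst.
Qed.

Lemma unit_cube_compact : compact unit_cube.
Proof.
have -> : unit_cube = [set v : 'rV[R]_d | forall i, `[0, 1]%classic (v ord0 i)].
  by apply/seteqP; split=> x h j; have := h j; rewrite /= in_itv.
apply: (@rV_compact R d (fun=> `[0, 1]%classic)) => _; exact: segment_compact.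
Qed.

Lemma unit_cube_closed : closed unit_cube.
Proof. by apply: compact_closed; [exact: norm_hausdorff|exact: unit_cube_compact]. Qed.

Lemma ifs_level_closed L : closed (ifs_level L).
Proof.
elim: L => [|L IH]; first exact: unit_cube_closed.
apply: closed_bigcup => [|i _]; first exact: finite_finset.
by apply: closed_comp => // x _; exact: homothety_inv_continuous.
Qed.

Lemma ifs_limit_compact : compact ifs_limit.
Proof.
apply: subclosed_compact unit_cube_compact ifs_limit_cube.
by apply: closed_bigI => L _; exact: ifs_level_closed.
Qed.

Lemma ifs_limit_nonempty : (0 < #|I|)%N -> rho < 1 -> ifs_limit !=set0.
Proof.
(* This is the fixed point of the homothety with index i. *)
move=> /card_gt0P[i _] rho_lt1; pose x := (1 - rho)^-1 *: tau i.
have xfix : homothety_inv i x = x.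
  rewrite -[RHS](homothetyK i); congr homothety_inv.
  rewrite /homothety /x scalerA -[X in _ = X + _]scale1r -scalerDl; congr (_ *: _).
  by field; lra.
exists x => L _; elim: L => [j|L IH]; last by exists i; rewrite //= xfix.
have /andP[t0 t1] := tau_cube i j.
rewrite /x !mxE mulr_ge0 ?invr_ge0 ?subr_ge0 ?(ltW rho_lt1) //=.
by rewrite mulrC ler_pdivrMr ?subr_gt0 // mul1r.
Qed.

Lemma homothety_similarity i : rho < 1 -> contracting_similarity (homothety i).
Proof.
move=> rho_lt1; exists rho; rewrite rho_gt0; split=> // x y.
by rewrite /homothety opprD addrACA subrr add0r -scalerBr enormZ gtr0_norm.
Qed.

Hypothesis tau_sep : forall i i', i != i' ->
  exists j, 2 * rho <= `|tau i ord0 j - tau i' ord0 j|.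

(** Pieces are cubes of side rho whose corners differ by at least 2 rho in some coordinate, so that
    distinct pieces keep a gap of at least rho there. *)
Lemma homothety_disjoint i i' x y : unit_cube x -> unit_cube y ->
  (forall j, `|homothety i x ord0 j - homothety i' y ord0 j| < rho) -> i = i'.
Proof.
move=> hx hy hxy; apply: contrapT => /eqP /tau_sep[j].
have := hxy j; have /andP[x0 x1] := hx j; have /andP[y0 y1] := hy j.
rewrite !mxE ltr_norml => /andP[h1 h2].
have rho_itv t : 0 <= t -> t <= 1 -> 0 <= rho * t <= rho.
  by move=> t0 t1; rewrite mulr_ge0 ?(ltW rho_gt0) // ler_piMr // ltW.
have /andP[? ?] := rho_itv _ x0 x1; have /andP[? ?] := rho_itv _ y0 y1.
rewrite leNgt => /negP; apply; rewrite ltr_norml; apply/andP; split; lra.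
Qed.

Lemma ifs_self_similar : (0 < #|I|)%N -> rho < 1 -> self_similar_OSC ifs_limit.
Proof.
move=> I0 rho_lt1; exists #|I|, (fun k => homothety (enum_val k)); split.
- by move=> k; exact: homothety_similarity.
(* The open set is the interior of the unit cube, that is, the sup norm ball of radius 1/2 about its
   centre. *)
- pose c : 'rV[R]_d := \row_j (1 / 2).
  have half : 0 < 1 / 2 :> R by lra.
  have inV x : ball c (1 / 2) x <-> forall j, 0 < x ord0 j < 1.
    split=> [[_ h] j|h].
      by have := h ord0 j; rewrite mxE /ball /= ltr_norml => /andP[? ?]; lra.
    split=> // i j; rewrite (ord1 i) mxE /ball /= ltr_norml.
    by have /andP[? ?] := h j; lra.
  have Vcube x : ball c (1 / 2) x -> unit_cube x.
    by move=> /inV h j; have /andP[? ?] := h j; lra.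
  exists (ball c (1 / 2)); split.
  + by exists c; exact: ballxx.
  + have /compact_bounded[M [Mr hM]] := unit_cube_compact.
    by exists M; split=> // e Me x /Vcube; exact: hM.
  + exact: ball_open.
  + move=> _ [k _ [x /inV hx <-]]; apply/inV => j; rewrite /homothety !mxE.
    have /andP[x0 x1] := hx j; have /andP[? ?] := tau_cube (enum_val k) j.
    have ? : 0 < rho * x ord0 j by rewrite mulr_gt0.
    have ? : rho * x ord0 j < rho by rewrite gtr_pMr.
    by apply/andP; split; lra.
  + move=> k k' _ _ [_ [[x hx <-] [y hy e]]].
    apply/enum_val_inj/(@homothety_disjoint _ _ x y); try exact: Vcube.
    by move=> j; rewrite e subrr normr0.
- split; [exact: ifs_limit_nonempty|exact: ifs_limit_compact|].
  rewrite [LHS]ifs_limitE; apply/seteqP; split=> [x [i _ hi]|x [k _ hk]].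
    by exists (enum_rank i); rewrite ?enum_rankK.
  by exists (enum_val k).
Qed.

(** * Addresses of points of the attractor *)

Variable i0 : I.
Hypothesis rho_lt1 : rho < 1.

(** The index of the piece that contains x; [i0] is a default value for points outside the
    attractor. *)
Definition digit (x : 'rV[R]_d) : I :=
  xget i0 [set i | ifs_limit (homothety_inv i x)].

Fixpoint address (L : nat) (x : 'rV[R]_d) : seq I :=
  if L is L'.+1 then digit x :: address L' (homothety_inv (digit x) x)
  else [::].

Lemma digitP x : ifs_limit x -> ifs_limit (homothety_inv (digit x) x).
Proof.
move=> /ifs_limit_inv hi.
exact: (@xgetPex _ i0 [set i | ifs_limit (homothety_inv i x)] hi).
Qed.

Lemma digit_close x y : ifs_limit x -> ifs_limit y ->
  (forall j, `|x ord0 j - y ord0 j| < rho) -> digit x = digit y.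
Proof.
move=> hx hy hxy.
apply: (homothety_disjoint (ifs_limit_cube (digitP hx)) (ifs_limit_cube (digitP hy))).
by rewrite !homothety_invK.
Qed.

Lemma digit_homothety i x : ifs_limit x -> digit (homothety i x) = i.
Proof.
move=> hx; have /digitP/ifs_limit_cube hd := ifs_limit_homothety i hx.
apply: (homothety_disjoint hd (ifs_limit_cube hx)) => j.
by rewrite homothety_invK subrr normr0.
Qed.

Lemma size_address L x : size (address L x) = L.
Proof. by elim: L x => //= L IH x; rewrite IH. Qed.

Lemma take_address l L x : (l <= L)%N -> take l (address L x) = address l x.
Proof. by elim: l L x => [|l IH] [|L] x //= lL; rewrite IH. Qed.

(** No cylinder is empty. Hence a cover of the attractor yields prefixes of all words, as
    [kraft_cover] requires. *)
Lemma address_surj w : exists2 x, ifs_limit x & address (size w) x = w.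
Proof.
elim: w => [|i w [x hx xw]].
  have I0 : (0 < #|I|)%N by apply/card_gt0P; exists i0.
  by have [x hx] := ifs_limit_nonempty I0 rho_lt1; exists x.
exists (homothety i x); first exact: ifs_limit_homothety.
by rewrite /= digit_homothety // homothetyK xw.
Qed.

(** The gap rho between first-level pieces scales to rho^L at level L: compare first digits, then
    blow up the common piece by 1/rho. *)
Lemma address_close L x y : ifs_limit x -> ifs_limit y ->
  (forall j, `|x ord0 j - y ord0 j| < rho ^+ L) -> address L x = address L y.
Proof.
elim: L x y => [//|L IH] x y hx hy hxy /=.
have dxy : digit x = digit y.
  apply: digit_close => // j; apply: lt_le_trans (hxy j) _.
  by rewrite exprS ler_piMr ?exprn_ile1 ?(ltW rho_gt0) ?(ltW rho_lt1).
rewrite dxy; congr cons; apply: IH; [by rewrite -dxy; exact: digitP|exact: digitP|].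
move=> j; rewrite !mxE -mulrBr opprB addrA subrK normrM gtr0_norm ?invr_gt0 //.
by rewrite mulrC ltr_pdivrMr // -exprSr.
Qed.

(** * Positive Hausdorff measure of the attractor *)

Let n := #|I|.

(* [p] is the word of a cylinder of mass n^-|p| that contains the part of U in the
   attractor; the error e is needed when that part is empty or U is a point, as
   diam_pow may vanish then. *)
Lemma ifs_small_set (U : set 'rV[R]_d) s e : 0 <= s -> 0 < e -> (1 < n)%N ->
  1 <= n%:R * rho `^ s -> (diam U <= (1 / 2)%:E)%E ->
  exists p : seq I,
    (forall x y, U x -> ifs_limit x -> ifs_limit y ->
      (forall j, `|x ord0 j - y ord0 j| < rho ^+ size p) ->
      address (size p) y = p) /\
    n%:R^-1 ^+ size p <= n%:R * fine (diam_pow s U) + e.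
Proof.
move=> s0 e0 n1 hn hU.
have n0 : 0 < n%:R :> R by rewrite ltr0n ltnW.
have /fineK : diam U \is a fin_num.
  by rewrite ge0_fin_numE ?diam_ge0 // (le_lt_trans hU) // ltry.
set D := fine _ => DE.
have D0 : 0 <= D by rewrite -lee_fin DE diam_ge0.
have D1 : D <= 1 / 2 by rewrite -lee_fin DE.
have small (e' : R) : 0 < e' -> exists l, n%:R^-1 ^+ l < e'.
  move=> e'0; apply: exists_expr_lt; rewrite ?invr_ge0 ?ler0n ?invf_lt1 ?ltr1n //.
have [/set0P[x0 [Ux0 Fx0]]|/negPn/eqP Uempty] := boolP (U `&` ifs_limit != set0); last first.
  have [l hl] := small e e0.
  exists (nseq l i0); rewrite size_nseq; split=> [x y Ux Fx|].
    by suff : set0 x by []; rewrite -Uempty.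
  by rewrite (le_trans (ltW hl)) // lerDr mulr_ge0 // ?ler0n // fine_ge0 // diam_pow_ge0.
(* All points of the attractor in U, and those close to them, lie in the level-l cylinder of x0. *)
have diam_l l : D < rho ^+ l -> forall x y, U x -> ifs_limit x -> ifs_limit y ->
    (forall j, `|x ord0 j - y ord0 j| < rho ^+ l) -> address l y = address l x0.
  move=> Dl x y Ux Fx Fy hxy; rewrite -(address_close Fx Fy hxy).
  apply: address_close => // j; apply: le_lt_trans Dl.
  rewrite -lee_fin DE; apply: le_trans (enorm_le_diam Ux Ux0).
  by rewrite lee_fin; have := coord_le_enorm (x - x0) j; rewrite !mxE.
have [D_eq0|D_neq0] := eqVneq D 0.
  have [l hl] := small e e0; exists (address l x0); rewrite size_address; split.
    by apply: diam_l; rewrite D_eq0 exprn_gt0.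
  by rewrite (le_trans (ltW hl)) // lerDr mulr_ge0 // ?ler0n // fine_ge0 // diam_pow_ge0.
have D_gt0 : 0 < D by rewrite lt_neqAle eq_sym D_neq0.
have D_lt1 : D < 1 by lra.
(* With rho^(l+1) <= D < rho^l, the hypothesis 1 <= n rho^s gives n^-l = n n^-(l+1) <= n
   rho^(s(l+1)) <= n D^s. *)
have [l /andP[lD Dl]] := exists_scale rho_gt0 rho_lt1 D_gt0 D_lt1.
exists (address l x0); rewrite size_address; split; first exact: diam_l.
have -> : diam_pow s U = (D `^ s)%:E.
  by rewrite /diam_pow asboolF -?DE // => U0; rewrite U0 in Ux0.
rewrite /= ler_wpDr ?(ltW e0) //.
apply: (@le_trans _ _ (n%:R * (rho ^+ l.+1) `^ s)); last first.
  by rewrite ler_pM2l // ge0_ler_powR // nnegrE // exprn_ge0 // ltW.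
rewrite -powR_mulrn ?(ltW rho_gt0) // powRAC powR_mulrn ?powR_ge0 //.
rewrite -ler_pdivrMl // -exprS lerXn2r ?nnegrE ?invr_ge0 ?powR_ge0 ?ler0n //.
by rewrite -[_^-1]mulr1 ler_pdivrMl.
Qed.

(* Neighbourhoods of the sets of a cover that only meet one cylinder each reduce
   the claim, by compactness, to Kraft's inequality for finitely many words. *)
Lemma ifs_hausdorff_measure_gt0 s : 0 <= s -> (1 < n)%N ->
  1 <= n%:R * rho `^ s -> (0 < hausdorff_measure s ifs_limit)%E.
Proof.
move=> s0 n1 hn; have n0 : 0 < n%:R :> R by rewrite ltr0n ltnW.
apply: (@lt_le_trans _ _ (hausdorff_premeasure s (1 / 2) ifs_limit)); last first.
  by apply: ereal_sup_ubound; exists (1 / 2) => //=; lra.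
apply: (@lt_le_trans _ _ (n%:R^-1 / 2)%:E); first by rewrite lte_fin divr_gt0 ?invr_gt0.
apply: le_ereal_inf_tmp => _ [U [hU FU] <-].
(* The errors (1/2)^(k+2) add up to less than 1/2, so Kraft's bound 1 leaves n times the sum of the
   [diam_pow] at least 1/2. *)
have half k : 0 < (1 / 2 : R) ^+ k.+2 by rewrite exprn_gt0 //; lra.
have /choice[p pP] := fun k => ifs_small_set s0 (half k) n1 hn (hU k).
pose O k : set 'rV[R]_d := \bigcup_(x in U k `&` ifs_limit) ball x (rho ^+ size (p k)).
have Oopen k : setT k -> open (O k).
  by move=> _; apply: bigcup_open => x _; exact: ball_open.
have FO : ifs_limit `<=` cover setT O.
  move=> x Fx; have [k _ Ux] := FU _ Fx; exists k => //; exists x => //.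
  by apply: ballxx; rewrite exprn_gt0.
have := ifs_limit_compact; rewrite compact_cover => /(_ _ _ _ Oopen FO)[D _ FD].
(* The finite subcover is enlarged to all indices below K, which only adds nonnegative terms; L is a
   common bound for the word lengths. *)
pose K := (\max_(k <- finmap.enum_fset D) k).+1.
pose L := \max_(i < K) size (p i).
have : 1 <= \sum_(i < K) (n%:R^-1 : R) ^+ size (p i).
  apply: (@kraft_cover R I K L (fun i => p i)) => [|i|w]; first exact: ltnW.
    exact: (@leq_bigmax _ (fun i : 'I_K => size (p i))).
  have [x Fx xw] := address_surj w; have [k kD [y [Uy Fy] [_ yx]]] := FD _ Fx.
  have kK : (k < K)%N by rewrite ltnS; apply: (@leq_bigmax_seq _ _ xpredT id).
  exists (Ordinal kK); rewrite /= -xw take_address.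
    by have [hp _] := pP k; apply: (hp y x) => // j; exact: yx.
  by rewrite size_tuple; exact: (@leq_bigmax _ (fun i : 'I_K => size (p i)) (Ordinal kK)).
have halfsum k : \sum_(i < k) (1 / 2 : R) ^+ i.+2 = 1 / 2 - (1 / 2) ^+ k.+1.
  elim: k => [|k IH]; first by rewrite big_ord0 expr1; lra.
  by rewrite big_ord_recr /= IH !exprS; field.
move=> h1; have : 1 <= \sum_(i < K) (n%:R * fine (diam_pow s (U i)) + (1 / 2 : R) ^+ i.+2).
  by apply: le_trans h1 _; apply: ler_sum => i _; have [] := pP i.
rewrite big_split /= -mulr_sumr halfsum => h2.
have h3 : n%:R^-1 / 2 <= \sum_(i < K) fine (diam_pow s (U i)).
  rewrite ler_pdivrMl //; have : 0 < (1 / 2 : R) ^+ K.+1 by rewrite exprn_gt0 //; lra.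
  by lra.
apply: (@le_trans _ _ (\sum_(0 <= i < K) diam_pow s (U i))%E); last first.
  by apply: nneseries_lim_ge => k _ _; exact: diam_pow_ge0.
rewrite big_mkord (eq_bigr (fun i : 'I_K => (fine (diam_pow s (U i)))%:E)).
  by rewrite sumEFin lee_fin.
move=> i _; rewrite fineK // ge0_fin_numE ?diam_pow_ge0 //.
by apply: le_lt_trans (diam_pow_le s0 (hU i)) _; rewrite ltry.
Qed.

Lemma ifs_hausdorff_dim : ((ln n%:R / - ln rho)%:E <= hausdorff_dim ifs_limit)%E.
Proof.
apply: le_ereal_inf_tmp => _ [s [s0 hs] <-]; rewrite lee_fin leNgt; apply/negP => sn.
have lnrho : ln rho < 0 by rewrite ln_lt0 // rho_gt0.
have I0 : (0 < n)%N by apply/card_gt0P; exists i0.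
have n1 : (1 < n)%N.
  (* For n = 1 the claimed bound is 0, and s is not negative. *)
  rewrite ltn_neqAle I0 andbT; apply: contraTneq sn => <-.
  by rewrite ln1 mul0r -leNgt.
have : (0 < hausdorff_measure s ifs_limit)%E.
  apply: ifs_hausdorff_measure_gt0 => //.
  rewrite -ler_ln ?posrE ?mulr_gt0 ?powR_gt0 ?ltr0n // ln1.
  rewrite lnM ?posrE ?powR_gt0 ?ltr0n // ln_powR.
  by move: sn; rewrite ltr_pdivlMr ?oppr_gt0 //; lra.
by rewrite hs ltxx.
Qed.

End HomothetyIFS.

(** * Avoiding approximate patches *)

Definition std_comb (R : realType) (d m k : nat) (x : 'I_m -> 'I_k) : 'rV[R]_d :=
  \sum_(i < m) (x i)%:R *: std_basis R d i.

Lemma std_combl (R : realType) m e k (x : 'I_m -> 'I_k) i :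
  std_comb R (m + e) x ord0 (lshift e i) = (x i)%:R.
Proof.
rewrite /std_comb std_basis_sum; case: insubP => [i' _ ii'|] /=.
  by congr ((x _)%:R); apply/val_inj.
by rewrite ltn_ord.
Qed.

Lemma std_combr (R : realType) m e k (x : 'I_m -> 'I_k) i :
  std_comb R (m + e) x ord0 (rshift m i) = 0.
Proof.
by rewrite /std_comb std_basis_sum insubF //=; apply/negbTE; rewrite -leqNgt leq_addr.
Qed.

Lemma std_comb_id (R : realType) m k (x : 'I_m -> 'I_k) i :
  std_comb R m x ord0 i = (x i)%:R.
Proof.
rewrite /std_comb std_basis_sum; case: insubP => [i' _ ii'|] /=.
  by congr ((x _)%:R); apply/val_inj.
by rewrite ltn_ord.
Qed.

Lemma intr_norm_lt1 (R : realType) (z : int) : `|z%:~R : R| < 1 -> z = 0.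
Proof. by rewrite -intr_norm (_ : 1 = 1%:~R) // ltr_int => h; lia. Qed.

Section DigitSet.
Variables (R : realType) (m e N k : nat) (A : {set {ffun 'I_m -> 'I_N}}) (eps : R).

Definition digits : finType :=
  ({a : {ffun 'I_m -> 'I_N} | a \in A} * {ffun 'I_e -> 'I_N})%type.

Definition digit_coord (a : digits) (j : 'I_(m + e)) : 'I_N :=
  match fintype.split j with inl i => val a.1 i | inr i => a.2 i end.

(* The mesh 7 eps satisfies 7 eps (N - 1) + eps / 4 < 1, so that the pieces stay in
   the unit cube, and exceeds twice the error 2 * 11/10 eps Delta + eps / 4 made
   for Delta <= 7/5 when differences of points are read off from the indices of
   their pieces. *)
Definition digit_shift (a : digits) : 'rV[R]_(m + e) :=
  \row_j (7 * eps * (digit_coord a j)%:R).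

Lemma card_digits : #|digits| = (#|A| * N ^ e)%N.
Proof. by rewrite card_prod card_sig card_ffun !card_ord; congr (_ * _)%N; apply: eq_card. Qed.

Lemma digit_coord_inj a b : digit_coord a =1 digit_coord b -> a = b.
Proof.
case: a b => [a a'] [b b'] h; congr pair.
  by apply/val_inj/ffunP => i; have := h (lshift e i); rewrite /digit_coord (unsplitK (inl _)).
by apply/ffunP => i; have := h (rshift m i); rewrite /digit_coord (unsplitK (inr _)).
Qed.

Hypothesis eps_gt0 : 0 < eps.
Hypothesis eps_lt : eps < 1 / 8.
Hypothesis N_le : N%:R - 1 <= 1 / (8 * eps).
Hypothesis m_gt0 : (0 < m)%N.
Hypothesis k_gt1 : (1 < k)%N.

Let rho := eps / 4.

Lemma digit_shift_cube a j : 0 <= digit_shift a ord0 j <= 1 - rho.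
Proof.
rewrite mxE; set i := digit_coord a j.
have : i%:R <= N%:R - 1 :> R by rewrite lerBrDr -(natrD _ _ 1) ler_nat addn1.
move=> /le_trans/(_ N_le) hi; rewrite !mulr_ge0 ?(ltW eps_gt0) //=.
have : eps * i%:R <= 1 / 8.
  apply: le_trans (ler_wpM2l (ltW eps_gt0) hi) _.
  by rewrite le_eqVlt; apply/orP; left; apply/eqP; field; rewrite gt_eqF.
by rewrite /rho -mulrA => h; have := eps_lt; lra.
Qed.

Lemma digit_shift_sep a b : a != b ->
  exists j, 2 * rho <= `|digit_shift a ord0 j - digit_shift b ord0 j|.
Proof.
move=> ab; have [j hj] : exists j, digit_coord a j != digit_coord b j.
  apply: contrapT => /forallNP h; case/eqP: ab; apply: digit_coord_inj => j.
  by apply/eqP/negPn/negP/h.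
exists j; rewrite !mxE -mulrBr normrM gtr0_norm ?mulr_gt0 //.
have : 1 <= `|(digit_coord a j)%:R - (digit_coord b j)%:R : R|.
  rewrite leNgt; apply/negP.
  rewrite !pmulrn -intrB => /intr_norm_lt1/eqP; rewrite subr_eq0 => /eqP[h].
  by case/eqP: hj; apply/val_inj.
by rewrite /rho; have := eps_gt0; nra.
Qed.

Definition digit_fractal : set 'rV[R]_(m + e) := ifs_limit rho digit_shift.

(* The constant 11/10 makes room for an infimum that is not attained. *)
Definition near_patch (Delta : R) : Prop :=
  exists (t : 'rV[R]_(m + e)) (y : ('I_m -> 'I_k) -> 'rV[R]_(m + e)), forall x,
    digit_fractal (y x) /\
    forall j, `|t ord0 j + Delta * std_comb R (m + e) x ord0 j - y x ord0 j|
                < 11 / 10 * eps * Delta.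

Lemma contains_AP_near_patch : contains_AP k eps (@std_basis R (m + e) m) digit_fractal ->
  exists2 Delta, 0 < Delta & near_patch Delta.
Proof.
move=> [Q [QF [Delta [P [D0 [t Pt] hP]]]]]; exists Delta => //.
have /choice[y hy] (x : 'I_m -> 'I_k) : exists y, Q y /\
    enorm (t + Delta *: std_comb R (m + e) x - y) < 11 / 10 * eps * Delta.
  have /ereal_inf_ltP[_ [y Qy <-]] : (ereal_inf
     [set (enorm (t + Delta *: std_comb R (m + e) x - y))%:E | y in Q] <
     (11 / 10 * eps * Delta)%:E)%E.
    apply: (@le_lt_trans _ _ (eps * Delta)%:E).
      apply: le_trans hP; apply: ereal_sup_ubound.
      by exists (t + Delta *: std_comb R (m + e) x) => //; rewrite Pt; exists x.
    by rewrite lte_fin ltr_pM2r // ltr_pMl //; lra.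
  by rewrite lte_fin => h; exists y.
exists t, y => x; have [Qy hxy] := hy x; split=> [|j]; first exact: QF.
apply: le_lt_trans hxy; apply: le_trans (coord_le_enorm _ j).
by rewrite !mxE.
Qed.

(** The patch points with all coefficients 0 and all coefficients 1 have approximations in the unit
    cube. Comparing first coordinates gives (1 - 11/5 eps) Delta <= 1, and 1 - 11/5 eps > 29/40 >
    5/7. *)
Lemma near_patch_le Delta : near_patch Delta -> Delta <= 7 / 5.
Proof.
move=> [t [y h]].
pose x0 : 'I_m -> 'I_k := fun=> Ordinal (ltnW k_gt1).
pose x1 : 'I_m -> 'I_k := fun=> Ordinal k_gt1.
pose j := lshift e (Ordinal m_gt0).
have [F0 /(_ j)] := h x0; have [F1 /(_ j)] := h x1.
rewrite !std_combl /= mulr1 mulr0 addr0 !ltr_norml => /andP[? ?] /andP[? ?].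
have /andP[? ?] := ifs_limit_cube F0 j; have /andP[? ?] := ifs_limit_cube F1 j.
have := eps_gt0; have := eps_lt; rewrite leNgt => ? ?; apply/negP => ?.
nra.
Qed.

Lemma near_patch_zoom Delta : ~ contains_patch R k A -> 0 < Delta ->
  near_patch Delta -> near_patch (Delta / rho).
Proof.
move=> noP Delta0 hD; have Dle := near_patch_le hD; case: hD => t [y hy].
have rho0 : 0 < rho by rewrite divr_gt0.
have tcube := digit_shift_cube; have tsep := digit_shift_sep.
pose x0 : 'I_m -> 'I_k := fun=> Ordinal (ltnW k_gt1).
have [Fy0 _] := hy x0.
have [a0 _] := ifs_limit_inv rho0 tcube Fy0.
pose a x := digit rho digit_shift a0 (y x).
have Fa x : digit_fractal (homothety_inv rho digit_shift (a x) (y x)).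
  by apply: (digitP rho0 tcube a0); have [] := hy x.
pose D x j : int := digit_coord (a x) j.
have yE x j : exists2 z, 0 <= z <= 1 & y x ord0 j = 7 * eps * (D x j)%:~R + rho * z.
  exists (homothety_inv rho digit_shift (a x) (y x) ord0 j).
    exact: (ifs_limit_cube (Fa x)).
  by rewrite -[in LHS](homothety_invK digit_shift rho0 (a x) (y x)) !mxE.
(* The difference of two piece indices, times the mesh 7 eps, is within half a mesh of the true
   displacement c Delta. *)
have hD x x' j c : std_comb R (m + e) x' ord0 j = std_comb R (m + e) x ord0 j + c ->
    `|7 * eps * (D x' j - D x j)%:~R - c * Delta| < 7 / 2 * eps.
  have [_ /(_ j)] := hy x; have [_ /(_ j)] := hy x'.
  have [z /andP[z0 z1] ->] := yE x j; have [z' /andP[z'0 z'1] ->] := yE x' j.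
  move=> + + sx; rewrite sx intrB !ltr_norml => /andP[h1 h2] /andP[h3 h4].
  have e0 := eps_gt0.
  have b1 : eps * Delta <= eps * (7 / 5) by rewrite ler_pM2l.
  have b2 : rho * z <= rho by rewrite ler_piMr // ltW.
  have b3 : rho * z' <= rho by rewrite ler_piMr // ltW.
  have b4 : 0 <= rho * z by rewrite mulr_ge0 // ltW.
  have b5 : 0 <= rho * z' by rewrite mulr_ge0 // ltW.
  rewrite /rho in h1 h2 h3 h4 b2 b3 b4 b5; apply/andP; split; lra.
(* Two integers whose multiples by the mesh are both within half a mesh of c Delta are equal: index
   differences depend only on the displacement c, not on the place or the direction. *)
have Dround x x' j u u' l c :
    std_comb R (m + e) x' ord0 j = std_comb R (m + e) x ord0 j + c ->
    std_comb R (m + e) u' ord0 l = std_comb R (m + e) u ord0 l + c ->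
    D x' j - D x j = D u' l - D u l.
  move=> /hD h1 /hD h2; apply/eqP; rewrite -subr_eq0; apply/eqP.
  apply: (@intr_norm_lt1 R); have e0 := eps_gt0.
  have : `|7 * eps * (D x' j - D x j - (D u' l - D u l))%:~R| < 7 * eps.
    rewrite [in X in `|X|]intrB; move: h1 h2; rewrite !ltr_norml.
    by move=> /andP[? ?] /andP[? ?]; apply/andP; split; lra.
  by rewrite normrM gtr0_norm ?mulr_gt0 // gtr_pMr ?mulr_gt0.
pose x1 : 'I_m -> 'I_k := fun=> Ordinal k_gt1.
pose j0 := lshift e (Ordinal m_gt0).
pose q := D x1 j0 - D x0 j0.
have x01 : std_comb R (m + e) x1 ord0 j0 = std_comb R (m + e) x0 ord0 j0 + 1.
  by rewrite !std_combl add0r.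
have D_same x x' j : std_comb R (m + e) x' ord0 j = std_comb R (m + e) x ord0 j ->
    D x' j = D x j.
  move=> sx; apply/eqP; rewrite -subr_eq0 -(subrr (D x0 j0)); apply/eqP.
  by apply: (Dround _ _ _ _ _ _ 0); rewrite addr0.
have Dr x i : D x (rshift m i) = D x0 (rshift m i).
  by apply: D_same; rewrite !std_combr.
have Dl x i : D x (lshift e i) = D x0 (lshift e i) + q * x i.
  (* The index in direction i depends only on x i, so x may be replaced by a constant family;
     raising the constant by one adds q. *)
  pose w c (hc : (c < k)%N) : 'I_m -> 'I_k := fun=> Ordinal hc.
  have -> : D x (lshift e i) = D (w _ (ltn_ord (x i))) (lshift e i).
    by apply: D_same; rewrite !std_combl.
  move: (nat_of_ord (x i)) (ltn_ord (x i)) => c; elim: c => [|c IH] hc.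
    by rewrite mulr0 addr0; apply: D_same; rewrite !std_combl.
  have /(Dround _ _ _ _ _ _ _) /(_ x01) : std_comb R (m + e) (w _ hc) ord0 (lshift e i) =
      std_comb R (m + e) (w _ (ltnW hc)) ord0 (lshift e i) + 1.
    by rewrite !std_combl /= -natr1.
  move/eqP; rewrite subr_eq IH -/q => /eqP->; rewrite intS; ring.
have q_ge0 : 0 <= q.
  (* From 7 eps q > Delta - 7/2 eps and Delta > 0 one gets q > -1/2, which suffices for an
     integer. *)
  have := hD _ _ _ _ x01; rewrite mul1r ltr_norml -/q => /andP[h _].
  have e0 := eps_gt0; have : -1 < q%:~R :> R by nra.
  by rewrite (_ : -1 = (-1)%:~R) // ltr_int; lia.
(* If q > 0, the indices form an exact patch of scale q in A. If q = 0, all points lie in one piece,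
   which is blown up by its inverse homothety. *)
have [q0|q_neq0] := eqVneq q 0; last first.
  case: noP; exists q%:~R, [set @grid_point R m N (val (a x0).1) +
    q%:~R *: std_comb R m x | x in [set: 'I_m -> 'I_k]].
  split; first by rewrite ltr0z lt_neqAle eq_sym q_neq0.
    by eexists.
  move=> _ [x _ <-]; exists (val (a x).1); first exact: valP.
  apply/rowP => i; rewrite !mxE std_comb_id; have := Dl x i.
  rewrite /D /digit_coord (unsplitK (inl _)) => h.
  by rewrite -!natr1 !pmulrn h intrD intrM; ring.
have aE x : a x = a x0.
  apply: digit_coord_inj => j; apply/val_inj.
  suff [] : D x j = D x0 j by [].
  by have [i ->|i ->] := split_ordP j; rewrite ?Dr // Dl q0 mul0r addr0.
exists (rho^-1 *: (t - digit_shift (a x0))),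
  (fun x => homothety_inv rho digit_shift (a x0) (y x)).
move=> x; split; first by rewrite -(aE x); exact: Fa.
move=> j; have [_ /(_ j)] := hy x; rewrite !mxE.
set T := t ord0 j; set S := std_comb _ _ _ _ _; set Y := y x ord0 j; set U := _ * _%:R.
have -> : rho^-1 * (T - U) + Delta / rho * S - rho^-1 * (Y - U) =
    rho^-1 * (T + Delta * S - Y) by ring.
by move=> h; rewrite normrM gtr0_norm ?invr_gt0 // (mulrA _ Delta) mulrC ltr_pM2r ?invr_gt0.
Qed.

Lemma digit_fractal_no_AP : ~ contains_patch R k A ->
  ~ contains_AP k eps (@std_basis R (m + e) m) digit_fractal.
Proof.
move=> noP /contains_AP_near_patch[Delta Delta0 hD].
have rho0 : 0 < rho by rewrite divr_gt0.
have rho1 : rho < 1 by rewrite /rho; have := eps_lt; lra.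
have zoom l : near_patch (Delta / rho ^+ l).
  elim: l => [|l IH]; first by rewrite expr0 divr1.
  rewrite exprSr invfM mulrA; apply: near_patch_zoom => //.
  by rewrite divr_gt0 // exprn_gt0.
(* Once rho^l < Delta / 2, the magnified scale Delta / rho^l exceeds 2 and hence 7/5. *)
have Delta2 : 0 < Delta / 2 by rewrite divr_gt0.
have [l hl] := exists_expr_lt (ltW rho0) rho1 Delta2.
have := near_patch_le (zoom l).
rewrite ler_pdivrMr ?exprn_gt0 //.
lra.
Qed.

End DigitSet.

(** * Orthonormal bases and subdivision of cubes *)

Lemma dotpE (R : realType) d (x y : 'rV[R]_d) : dotp x y = (x *m y^T) ord0 ord0.
Proof. by rewrite mxE; apply: eq_bigr => i _; rewrite mxE. Qed.

(** The n rows have rank less than d, so the kernel of M^T contains a nonzero vector, which is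
    normalised. *)
Lemma exists_unit_orthogonal (R : realType) d n (M : 'M[R]_(n, d)) : (n < d)%N ->
  exists2 u : 'rV[R]_d, enorm u = 1 & u *m M^T = 0.
Proof.
move=> nd.
have : kermx M^T != 0.
  rewrite -mxrank_eq0 mxrank_ker mxrank_tr -lt0n subn_gt0.
  by apply: leq_ltn_trans nd; exact: rank_leq_row.
move=> /rowV0Pn[u /sub_kermxP uM u0].
have un : 0 < enorm u.
  rewrite lt_neqAle enorm_ge0 andbT eq_sym; apply: contra_neq u0 => u0.
  apply/rowP => j; rewrite mxE; apply/eqP; rewrite -normr_le0 -u0.
  exact: coord_le_enorm.
exists ((enorm u)^-1 *: u); last by rewrite -scalemxAl uM scaler0.
by rewrite enormZ gtr0_norm ?invr_gt0 // mulVf ?gt_eqF.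
Qed.

Lemma orthonormal_rows_extend (R : realType) m d f (V : 'M[R]_(m, d)) :
  (m + f <= d)%N -> V *m V^T = 1%:M ->
  exists U : 'M[R]_(f, d), U *m U^T = 1%:M /\ V *m U^T = 0.
Proof.
move=> + V1; elim: f => [|f IH] mfd.
  by exists 0; split; [apply/matrixP => -[]|rewrite trmx0 mulmx0].
have [U [U1 VU]] := IH (leq_trans (leq_add (leqnn m) (leqnSn f)) mfd).
have mfd' : (m + f < d)%N by rewrite -addnS.
have [u u1] := exists_unit_orthogonal (col_mx V U) mfd'.
rewrite tr_col_mx mul_mx_row -(row_mx0 _ 1 m f) => /eq_row_mx[uV uU].
have Vu : V *m u^T = 0 by apply: (can_inj (@trmxK _ _ _)); rewrite trmx_mul trmxK uV trmx0.
have Uu : U *m u^T = 0 by apply: (can_inj (@trmxK _ _ _)); rewrite trmx_mul trmxK uU trmx0.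
have uu : u *m u^T = 1%:M.
  apply/matrixP => i j; rewrite (ord1 i) (ord1 j) [RHS]mxE eqxx -dotpE.
  by rewrite -[LHS]sqr_sqrtr ?dotp_ge0 // -/(enorm u) u1 expr1n.
(* The successor of f is convertible to 1 + f, the row count of the block matrix with u on top of
   U. *)
change (exists U : 'M[R]_(1 + f, d), U *m U^T = 1%:M /\ V *m U^T = 0).
exists (col_mx u U); rewrite tr_col_mx mul_col_row mul_mx_row Vu VU row_mx0 uu uU Uu U1.
by rewrite -scalar_mx_block.
Qed.

Lemma orthonormal_complete (R : realType) m e (v : 'I_m -> 'rV[R]_(m + e)) :
  orthonormal_family v ->
  exists2 W : 'M[R]_(m + e), W *m W^T = 1%:M & forall i, row (lshift e i) W = v i.
Proof.
move=> [v1 v0]; pose V := \matrix_i v i.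
have rowV i : row i V = v i by exact: rowK.
have V1 : V *m V^T = 1%:M.
  apply/matrixP => i j; rewrite !mxE.
  transitivity (dotp (v i) (v j)).
    by apply: eq_bigr => l _; rewrite !mxE.
  have [<-|ij] := eqVneq i j; last by rewrite v0 // mulr0n.
  by rewrite -[LHS]sqr_sqrtr ?dotp_ge0 // -/(enorm _) v1 expr1n.
have [U [U1 VU]] := orthonormal_rows_extend (leqnn _) V1.
exists (col_mx V U) => [|i]; last first.
  rewrite rowEsub -rowV; apply/rowP => j.
  by rewrite !mxE (unsplitK (inl _)) mxE.
rewrite tr_col_mx mul_col_row V1 VU U1.
have -> : U *m V^T = 0 by apply: (can_inj (@trmxK _ _ _)); rewrite trmx_mul trmxK VU trmx0.
by rewrite -scalar_mx_block.
Qed.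

(** * Rotation to the standard basis *)

Lemma assouad_dim_isometry (R : realType) d (f : 'rV[R]_d -> 'rV[R]_d) F :
  (forall x y, enorm (f x - f y) = enorm (x - y)) ->
  (assouad_dim F <= assouad_dim (f @` F))%E.
Proof.
move=> fiso; apply: ereal_inf_le_tmp => _ [s [s0 [C [C0 hC]]] <-]; exists s => //.
split=> //; exists C; split=> // r r0 rho rrho x Fx.
have Ffx : [set f y | y in F] (f x) by exists x.
apply: (le_trans _ (hC r r0 rho rrho (f x) Ffx)).
apply: ereal_inf_le_tmp => _ [n [U [Ur FU]] <-]; exists n => //.
exists (fun i => f @^-1` U i); split=> [i|y [yx Fy]].
  apply: diam_le (ltW r0) _ => y z Uy Uz; rewrite -fiso -lee_fin.
  by apply: (le_trans _ (Ur i)); exact: enorm_le_diam.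
have [|i _ Ui] := FU (f y); last by exists i.
by split; [rewrite /ecball /= fiso|exists y].
Qed.

Lemma enorm_rotate (R : realType) d (W : 'M[R]_d) (x : 'rV[R]_d) :
  W *m W^T = 1%:M -> enorm (x *m W^T) = enorm x.
Proof.
move=> /mulmx1C W1; rewrite /enorm !dotpE trmx_mul trmxK mulmxA.
by rewrite -(mulmxA x) W1 mulmx1.
Qed.

Lemma contains_AP_intro (R : realType) d m k eps (v : 'I_m -> 'rV[R]_d) F t Delta :
  0 < Delta ->
  (forall x : 'I_m -> 'I_k, exists2 y, F y &
    enorm (t + Delta *: (\sum_(i < m) (x i)%:R *: v i) - y) <= eps * Delta) ->
  contains_AP k eps v F.
Proof.
move=> Delta0 h; exists F; split=> //; eexists; eexists; split; [exact: Delta0|by exists t|].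
apply: ge_ereal_sup => _ [_ [x _ <-] <-]; have [y Fy hy] := h x.
apply: (@le_trans _ _ (enorm (t + Delta *: (\sum_(i < m) (x i)%:R *: v i) - y))%:E).
  by apply: ereal_inf_lbound; exists y.
by rewrite lee_fin.
Qed.

(** The map y -> y W^T takes coordinates along the rows of W and so sends v to the first m standard
    basis vectors; multiplication by W carries an approximate patch back. *)
Lemma no_AP_rotate (R : realType) m e k eps (v : 'I_m -> 'rV[R]_(m + e))
    (W : 'M[R]_(m + e)) (F : set 'rV[R]_(m + e)) :
  W *m W^T = 1%:M -> (forall i, row (lshift e i) W = v i) -> ~ contains_AP k eps v F ->
  forall t Delta, 0 < Delta -> ~ (forall x : 'I_m -> 'I_k,
    exists2 z, [set y *m W^T | y in F] z &
      enorm (t + Delta *: std_comb R (m + e) x - z) <= eps * Delta).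
Proof.
move=> W1 Wv noAP t Delta Delta0 h; apply: noAP.
apply: (@contains_AP_intro _ _ _ _ _ _ _ (t *m W) Delta) => // x.
have [_ [y Fy <-]] := h x; rewrite -(@enorm_rotate _ _ W^T) ?trmxK ?(mulmx1C W1) //.
rewrite mulmxBl -mulmxA (mulmx1C W1) mulmx1 mulmxDl -scalemxAl mulmx_suml => hy.
exists y => //; apply: le_trans hy; rewrite le_eqVlt; apply/orP; left; apply/eqP.
congr (enorm (_ + _ *: _ - _)); apply: eq_bigr => i _; rewrite -scalemxAl; congr (_ *: _).
rewrite -Wv; apply/rowP => j; rewrite !mxE (bigD1 (lshift e i)) //= mxE eqxx mul1r.
rewrite big1 ?addr0 // => l li; rewrite mxE; suff /negbTE-> : val l != val i by rewrite mul0r.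
by apply: contraNneq li => h'; apply/eqP/val_inj.
Qed.

Lemma contains_patch_card_le (R : realType) k m N (A : {set {ffun 'I_m -> 'I_N}}) :
  ~ contains_patch R k A -> (#|A| <= max_patch_free R k m N)%N.
Proof.
move=> h; apply: (@leq_bigmax_cond _ (fun A => `[< ~ contains_patch R k A >]) (fun A => #|A|)).
exact/asboolP.
Qed.

(** Half-open, so that grid cells tile a cube exactly and rounding down finds the cell of a
    point. *)
Definition hcube (R : realType) d (c : 'rV[R]_d) (l : R) : set 'rV[R]_d :=
  [set y | forall j, c ord0 j <= y ord0 j < c ord0 j + l].

Lemma hcube_diam (R : realType) d (c : 'rV[R]_d) l : 0 <= l ->
  (diam (hcube c l) <= (Num.sqrt d%:R * l)%:E)%E.
Proof.
move=> l0; apply: diam_le => [|x y hx hy]; first by rewrite mulr_ge0 ?sqrtr_ge0.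
apply: enorm_le => j; have /andP[? ?] := hx j; have /andP[? ?] := hy j.
by rewrite !mxE ler_norml; apply/andP; split; lra.
Qed.

(** * Counting the cells that meet a set without approximate patches *)

Section Subdivision.
Variables (R : realType) (m e k N : nat) (eps : R) (F : set 'rV[R]_(m + e)).
Hypothesis m_gt0 : (0 < m)%N.
Hypothesis k_gt1 : (1 < k)%N.
Hypothesis N_gt0 : (0 < N)%N.
Hypothesis N_ge : Num.sqrt (m + e)%:R <= eps * N%:R.
Hypothesis noAP : forall t Delta, 0 < Delta -> ~ (forall x : 'I_m -> 'I_k,
    exists2 z, F z & enorm (t + Delta *: std_comb R (m + e) x - z) <= eps * Delta).

(** What remains of a cell index once the quotients u are removed: remainders modulo N in the first
    m directions, full indices below N^2 in the other e. *)
Let residues : finType := ({ffun 'I_m -> 'I_N} * {ffun 'I_e -> 'I_(N * N)})%type.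

Let M := (max_patch_free R k m N * N ^ (m + e + e))%N.

Lemma card_residues : #|residues| = (N ^ (m + e + e))%N.
Proof. by rewrite card_prod !card_ffun !card_ord expnMn !expnD mulnA. Qed.

Definition cell_corner (c : 'rV[R]_(m + e)) (h : R) (u : {ffun 'I_m -> 'I_N})
    (p : {ffun 'I_m -> 'I_N} * {ffun 'I_e -> 'I_(N * N)}) : 'rV[R]_(m + e) :=
  \row_j (c ord0 j + h * match fintype.split j with
    | inl i => N%:R * (u i)%:R + (p.1 i)%:R
    | inr i => (p.2 i)%:R end).

Definition met_cells c h p : {set {ffun 'I_m -> 'I_N}} :=
  [set u | `[< F `&` hcube (cell_corner c h u p) h !=set0 >]]%SET.

Lemma met_cells_patch_free c h p : 0 < h -> ~ contains_patch R k (met_cells c h p).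
Proof.
move=> h0 [D [P [D0 [t ->] hP]]].
have /choice[u hu] (x : 'I_m -> 'I_k) : exists u, u \in met_cells c h p /\
    (* The -1 undoes the shift in [grid_point]. *)
    forall i, (u i)%:R = t ord0 i - 1 + D * (x i)%:R :> R.
  have [|u uA ut] := hP (t + D *: std_comb R m x); first by exists x.
  exists u; split=> // i; have /rowP/(_ i) := ut.
  by rewrite !mxE std_comb_id -natr1 => e1; apply: (addIr 1); rewrite e1; ring.
(* D is positive and a difference of two integers. *)
have D1 : 1 <= D.
  have [_ /(_ (Ordinal m_gt0))] := hu (fun=> Ordinal (ltnW k_gt1)).
  have [_ /(_ (Ordinal m_gt0))] := hu (fun=> Ordinal k_gt1).
  rewrite /= mulr1 mulr0; set a := u _ _; set b := u _ _ => ha hb.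
  have : b%:R < a%:R :> R by rewrite ha hb; lra.
  by rewrite ltr_nat -(ler_nat R) -natr1 ha hb => ?; lra.
pose s := cell_corner c h (u (fun=> Ordinal (ltnW k_gt1))) p.
apply: (@noAP s (D * (h * N%:R))); first by rewrite !mulr_gt0 // ltr0n.
move=> x; have [+ ux] := hu x; rewrite inE => /asboolP[y [Fy hy]]; exists y => //.
have -> : s + (D * (h * N%:R)) *: std_comb R (m + e) x = cell_corner c h (u x) p.
  apply/rowP => j; have [i ->|i ->] := split_ordP j.
    rewrite !mxE (unsplitK (inl _)) std_combl ux.
    by have [_ ->] := hu (fun=> Ordinal (ltnW k_gt1)); rewrite /=; ring.
  by rewrite !mxE (unsplitK (inr _)) std_combr mulr0 addr0.
(* The cell corners form an exact patch of scale D h N, and a point of F in the same cell is within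
   sqrt(m + e) h <= eps N h <= eps D h N. *)
apply: (@le_trans _ _ (Num.sqrt (m + e)%:R * h)).
  move: (cell_corner c h (u x) p) hy => z hy.
  apply: enorm_le => j; have /andP[z1 z2] := hy j.
  by rewrite !mxE ler_norml; apply/andP; split; lra.
apply: (@le_trans _ _ (eps * N%:R * h)); first by rewrite ler_pM2r.
have -> : eps * (D * (h * N%:R)) = D * (eps * N%:R * h) by ring.
rewrite ler_peMl // mulr_ge0 ?(ltW h0) // (le_trans _ N_ge) // sqrtr_ge0.
Qed.

Lemma hcube_subdivide c l : 0 < l -> exists2 s : seq 'rV[R]_(m + e), (size s <= M)%N &
  F `&` hcube c l `<=` [set y | exists2 c', c' \in s & hcube c' (l / N%:R ^+ 2) y].
Proof.
move=> l0; have N0 : 0 < N%:R :> R by rewrite ltr0n.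
set h := l / _; have h0 : 0 < h by rewrite divr_gt0 // exprn_gt0.
pose Q (w : {ffun 'I_m -> 'I_N} * residues) := w.1 \in met_cells c h w.2.
exists [seq cell_corner c h w.1 w.2 | w <- enum Q].
  rewrite size_map -cardE -sum1_card big_mkcond /=.
  rewrite -(pair_bigA _ (fun u p => if Q (u, p) then 1%N else 0%N)) exchange_big /=.
  rewrite /M -card_residues mulnC -sum_nat_const; apply: leq_sum => p _.
  rewrite -big_mkcond (eq_bigl (fun u => u \in met_cells c h p)) // sum1_card.
  exact/contains_patch_card_le/met_cells_patch_free.
move=> y [Fy hy].
(* The index of the cell of y; in the first m directions its quotient and remainder modulo N give u
   and r. *)
pose n j := Num.truncn ((y ord0 j - c ord0 j) / h).
have nP j : (n j)%:R <= (y ord0 j - c ord0 j) / h < (n j).+1%:R.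
  apply: truncn_itv; rewrite divr_ge0 ?(ltW h0) // subr_ge0.
  by have /andP[] := hy j.
have nN j : (n j < N * N)%N.
  have /andP[nj _] := nP j; rewrite -(ltr_nat R); apply: le_lt_trans nj _.
  rewrite ltr_pdivrMr // natrM -expr2 mulrC divfK ?gt_eqF ?exprn_gt0 //.
  by have /andP[_] := hy j; rewrite ltrBlDl.
have hu i : (n (lshift e i) %/ N < N)%N by rewrite ltn_divLR.
pose u : {ffun 'I_m -> 'I_N} := [ffun i => Ordinal (hu i)].
pose r : {ffun 'I_m -> 'I_N} := [ffun i => Ordinal (ltn_pmod (n (lshift e i)) N_gt0)].
pose b : {ffun 'I_e -> 'I_(N * N)} := [ffun i => Ordinal (nN (rshift m i))].
have hc : hcube (cell_corner c h u (r, b)) h y.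
  move=> j; suff -> : cell_corner c h u (r, b) ord0 j = c ord0 j + h * (n j)%:R.
    have /andP[h1 h2] := nP j; move: h1 h2; rewrite ler_pdivlMr // ltr_pdivrMr // -natr1.
    by move=> ? ?; apply/andP; split; lra.
  rewrite mxE; congr (_ + _ * _); have [i ->|i ->] := split_ordP j.
    by rewrite !ffunE /= -natrM -natrD mulnC -divn_eq.
  by rewrite ffunE.
exists (cell_corner c h u (r, b)) => //; apply/mapP; exists (u, (r, b)) => //.
rewrite mem_enum; change (u \in met_cells c h (r, b)).
by rewrite inE; apply/asboolP; exists y.
Qed.

Lemma hcube_iterate L c l : 0 < l -> exists2 s : seq 'rV[R]_(m + e), (size s <= M ^ L)%N &
  F `&` hcube c l `<=`
  [set y | exists2 c', c' \in s & hcube c' (l / (N%:R ^+ 2) ^+ L) y].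
Proof.
move=> l0; have N0 : 0 < N%:R :> R by rewrite ltr0n.
elim: L => [|L [s sM hs]].
  exists [:: c] => // y [_ hy]; exists c; first exact: mem_head.
  by rewrite expr0 divr1.
have h0 : 0 < l / (N%:R ^+ 2) ^+ L by rewrite divr_gt0 // !exprn_gt0.
have /choice[f hf] c' : exists t : seq 'rV[R]_(m + e), (size t <= M)%N /\
    F `&` hcube c' (l / (N%:R ^+ 2) ^+ L) `<=`
    [set y | exists2 c', c' \in t & hcube c' (l / (N%:R ^+ 2) ^+ L.+1) y].
  have [t tM ht] := hcube_subdivide c' h0; exists t; split=> //.
  by rewrite [_ ^+ L.+1]exprSr invfM mulrA.
exists (flatten [seq f c' | c' <- s]) => [|y [Fy hy]].
  rewrite size_flatten sumnE !big_map expnS; apply: leq_trans (leq_mul (leqnn M) sM).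
  rewrite mulnC -sum1_size big_distrl /=.
  by apply: leq_sum => c' _; rewrite mul1n; have [] := hf c'.
have [c' c's hc'] := hs y (conj Fy hy).
have [_ /(_ y (conj Fy hc'))[c'' c''f hc'']] := hf c'.
by exists c'' => //; apply/flatten_mapP; exists c'.
Qed.

(** Write M = (N^2)^sigma and enclose the ball in a cube of side 3 rho. If (N^2)^-(L+1) <= r / (a
    rho) < (N^2)^-L, then L + 1 subdivisions give cells of diameter at most r, and at most M^(L+1)
    <= M (a rho / r)^sigma of them are needed. *)
Lemma assouad_dim_le : (1 < N)%N -> (0 < max_patch_free R k m N)%N ->
  (assouad_dim F <= (ln M%:R / ln (N%:R ^+ 2))%:E)%E.
Proof.
move=> N1 r0; set sigma := _ / _.
have N0 : 0 < N%:R :> R by rewrite ltr0n.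
have M0 : 0 < M%:R :> R by rewrite ltr0n muln_gt0 r0 expn_gt0 N_gt0.
have Nsq1 : 1 < N%:R ^+ 2 :> R by rewrite expr_gt1 ?ltr1n // ler0n.
have Nsq0 : 0 < N%:R ^+ 2 :> R by rewrite exprn_gt0.
have ME : M%:R = (N%:R ^+ 2 : R) `^ sigma.
  by rewrite /powR gt_eqF // divfK ?lnK ?posrE // gt_eqF // ln_gt0.
have sigma0 : 0 <= sigma.
  by rewrite divr_ge0 // ln_ge0 ?(ltW Nsq1) // ler1n -(ltr0n R).
pose a := 3 * Num.sqrt (m + e)%:R : R.
have sd1 : 1 <= Num.sqrt (m + e)%:R :> R.
  by rewrite -[leLHS]sqrtr1 ler_wsqrtr // ler1n addn_gt0 m_gt0.
have a0 : 0 < a by rewrite mulr_gt0 // (lt_le_trans _ sd1).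
apply: ereal_inf_lbound; exists sigma => //; split=> //.
exists (M%:R * a `^ sigma); split; first by rewrite mulr_gt0 ?powR_gt0.
move=> r r_gt0 rho rrho x Fx; have rho0 : 0 < rho by exact: lt_trans rrho.
have arho0 : 0 < a * rho by exact: mulr_gt0.
have D0 : 0 < r / (a * rho) by exact: divr_gt0.
have D1 : r / (a * rho) < 1.
  rewrite ltr_pdivrMr // mul1r (lt_le_trans rrho) // ler_peMl ?(ltW rho0) //.
  by rewrite /a; lra.
have q0 : 0 < (N%:R ^+ 2 : R)^-1 by rewrite invr_gt0.
have q1 : (N%:R ^+ 2 : R)^-1 < 1 by rewrite invf_lt1.
have [L /andP[L1 L2]] := exists_scale q0 q1 D0 D1.
rewrite !exprVn in L1 L2.
(* Side 3 rho rather than 2 rho, since the half-open cube has to contain a closed ball. *)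
pose c := x - const_mx rho.
have l0 : 0 < 3 * rho by rewrite mulr_gt0.
have [s sM hs] := hcube_iterate L.+1 c l0.
apply: (@le_trans _ _ (size s)%:R%:E).
  apply: ereal_inf_lbound; exists (size s) => //.
  exists (fun i => hcube (nth 0 s i) (3 * rho / (N%:R ^+ 2) ^+ L.+1)); split=> [i|y [yx Fy]].
    apply: le_trans (hcube_diam _ _) _.
      by rewrite divr_ge0 ?(ltW l0) // exprn_ge0 // ltW.
    rewrite lee_fin; move: L1; rewrite ler_pdivlMr // /a.
    by apply: le_trans; rewrite le_eqVlt; apply/orP; left; apply/eqP; ring.
  have [|c' c's hc'] := hs y.
    split=> // j; have := le_trans (coord_le_enorm _ j) yx.
    by rewrite !mxE ler_norml => /andP[? ?]; apply/andP; split; lra.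
  have c'i : (index c' s < size s)%N by rewrite index_mem.
  by exists (Ordinal c'i) => //=; rewrite nth_index.
rewrite lee_fin; apply: (@le_trans _ _ (M%:R ^+ L.+1)).
  by rewrite -natrX ler_nat.
rewrite exprS -mulrA ler_pM2l // -powRM ?(ltW a0) ?divr_ge0 ?(ltW rho0) ?(ltW r_gt0) //.
rewrite {1}ME -[_ ^+ L]powR_mulrn ?powR_ge0 // powRAC powR_mulrn ?(ltW Nsq0) //.
apply: ge0_ler_powR; rewrite ?nnegrE ?exprn_ge0 ?(ltW Nsq0) //.
  by rewrite mulr_ge0 ?(ltW a0) // divr_ge0 ?(ltW rho0) ?(ltW r_gt0).
rewrite -[leLHS]invrK -[leRHS]invrK lef_pV2 ?posrE ?invr_gt0 ?exprn_gt0 //; last first.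
  by rewrite mulr_gt0 // divr_gt0.
by rewrite ltW //; move: L2; rewrite mulrA invf_div.
Qed.

End Subdivision.

(** * The bounds *)

Lemma max_patch_free_witness (R : realType) k m N : (0 < k)%N ->
  exists2 A : {set {ffun 'I_m -> 'I_N}}, ~ contains_patch R k A &
    #|A| = max_patch_free R k m N.
Proof.
move=> k0.
pose good := [pred A : {set {ffun 'I_m -> 'I_N}} | `[< ~ contains_patch R k A >]].
have good0 : (0 < #|good|)%N.
  apply/card_gt0P; exists finset.set0; apply/asboolP => -[D [P [_ [t ->] hP]]].
  have [|u] := hP (t + D *: \sum_(i < m) (Ordinal k0 : nat)%:R *: std_basis R m i).
    by exists (fun=> Ordinal k0).
  by rewrite /= inE.
have [A /asboolP noA EA] := eq_bigmax_cond (fun A : {set {ffun 'I_m -> 'I_N}} => #|A|) good0.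
by exists A.
Qed.

(** A singleton is patch-free, because a patch with k >= 2 and m >= 1 has two distinct points. *)
Lemma max_patch_free_gt0 (R : realType) k m N : (1 < k)%N -> (0 < m)%N -> (0 < N)%N ->
  (0 < max_patch_free R k m N)%N.
Proof.
move=> k1 m0 N0; rewrite -(cards1 ([ffun=> Ordinal N0] : {ffun 'I_m -> 'I_N})).
apply: (@contains_patch_card_le R) => -[D [P [D0 [t ->] hP]]].
have h (c : 'I_k) : t + D *: std_comb R m (fun _ : 'I_m => c) =
    @grid_point R m N [ffun=> Ordinal N0].
  have [|u uA <-] := hP (t + D *: std_comb R m (fun _ : 'I_m => c)); first by exists (fun=> c).
  by move: uA => /=; rewrite inE => /eqP->.
have /rowP/(_ (Ordinal m0)) : D *: std_comb R m (fun _ : 'I_m => Ordinal k1) =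
    D *: std_comb R m (fun _ : 'I_m => Ordinal (ltnW k1)) by apply: (addrI t); rewrite !h.
rewrite !mxE !std_comb_id /= mulr1 mulr0.
by move/eqP; rewrite gt_eqF.
Qed.

Lemma nat_ceilE (R : realType) (x : R) : 0 < x -> (nat_ceil x)%:R = (Num.ceil x)%:~R :> R.
Proof. by move=> x0; rewrite /nat_ceil natr_absz ger0_norm // ltW // ceil_gt0. Qed.

Lemma nat_ceil_ge (R : realType) (x : R) : 0 < x -> x <= (nat_ceil x)%:R.
Proof. by move=> x0; rewrite nat_ceilE // ceil_ge. Qed.

Lemma nat_ceilB1_lt (R : realType) (x : R) : 0 < x -> (nat_ceil x)%:R - 1 < x.
Proof. by move=> x0; rewrite nat_ceilE //; have := ceilB1_lt x; rewrite intrB. Qed.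

Lemma coord_le_norm (R : realType) d (x : 'rV[R]_d) j : `|x ord0 j| <= `|x|.
Proof.
rewrite [leRHS]/Num.norm /= mx_normrE.
exact: (le_bigmax _ (fun ij : 'I_1 * 'I_d => `|x ij.1 ij.2|) (ord0, j)).
Qed.

Lemma D_S_le_D_A (R : realType) k (eps : R) d m : (m <= d)%N ->
  (D_S k eps d m <= D_A k eps d m)%E.
Proof.
move=> md; apply: ge_ereal_sup => _ [F [[n [f [_ _ [_ Fc _]]]] noAP] <-].
apply: (@le_trans _ _ (assouad_dim F)); last first.
  apply: ereal_sup_ubound; exists F => //; exists (@std_basis R d m).
  by split=> //; exact: std_basis_orthonormal.
have [M [_ hM]] := compact_bounded Fc.
apply: (@hausdorff_le_assouad _ _ _ (M + 1)) => x Fx j.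
by apply: le_trans (coord_le_norm x j) _; apply: hM => //; rewrite ltrDl.
Qed.

Lemma D_S_ge (R : realType) k (eps : R) m e N : (0 < m)%N -> (1 < k)%N ->
  0 < eps -> eps < 1 / 8 -> (0 < N)%N -> N%:R - 1 <= 1 / (8 * eps) ->
  ((ln ((max_patch_free R k m N)%:R * N%:R ^+ e) / ln (4 / eps))%:E
    <= D_S k eps (m + e) m)%E.
Proof.
move=> m0 k1 eps0 eps1 N0 hN.
have [A noA cA] := @max_patch_free_witness R k m N (ltnW k1).
have rho0 : 0 < eps / 4 by rewrite divr_gt0.
have rho1 : eps / 4 < 1 by lra.
have tcube := digit_shift_cube (e := e) (A := A) eps0 eps1 hN.
have tsep := digit_shift_sep (e := e) (A := A) eps0.
have cardD : #|digits e A| = (max_patch_free R k m N * N ^ e)%N.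
  by rewrite card_digits cA.
have D0 : (0 < #|digits e A|)%N.
  by rewrite cardD muln_gt0 expn_gt0 N0 max_patch_free_gt0.
have [a0 _] := card_gt0P D0.
have hS : (hausdorff_dim (@digit_fractal R m e N A eps) <= D_S k eps (m + e) m)%E.
  apply: ereal_sup_ubound; exists (@digit_fractal R m e N A eps) => //; split.
    exact: ifs_self_similar.
  exact: digit_fractal_no_AP.
apply: (le_trans _ hS).
apply: (le_trans _ (ifs_hausdorff_dim rho0 tcube tsep a0 rho1)).
rewrite cardD natrM natrX lee_fin le_eqVlt; apply/orP; left; apply/eqP.
by congr (_ / _); rewrite -lnV ?posrE // invf_div.
Qed.

Lemma D_A_le (R : realType) k (eps : R) m e N : (0 < m)%N -> (1 < k)%N -> (1 < N)%N ->
  Num.sqrt (m + e)%:R <= eps * N%:R ->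
  (D_A k eps (m + e) m <=
    (ln ((max_patch_free R k m N * N ^ (m + e + e))%:R) / ln (N%:R ^+ 2))%:E)%E.
Proof.
move=> m0 k1 N1 hN; apply: ge_ereal_sup => _ [F [v [vo noAP]] <-].
have [W W1 Wv] := orthonormal_complete vo.
apply: (@le_trans _ _ (assouad_dim [set y *m W^T | y in F])).
  apply: assouad_dim_isometry => x y.
  by rewrite -mulmxBl enorm_rotate.
apply: (assouad_dim_le m0 k1 (ltnW N1) hN (no_AP_rotate W1 Wv noAP) N1).
by apply: max_patch_free_gt0 => //; exact: ltnW.
Qed.

Theorem corollary2p3 (R : realType) (d m k : nat) (eps : R)
    (hd : (1 <= d)%N) (hm : (1 <= m)%N) (hmd : (m <= d)%N)
    (hk : (2 <= k)%N) (hk1 : d = 1%N -> (3 <= k)%N)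
    (heps0 : 0 < eps) (heps1 : eps < 1 / 8) :
  (let N := nat_ceil (1 / (8 * eps)) in
   ((d%:R * (1 - ln 32 / ln (4 / eps))
      + ln ((max_patch_free R k m N)%:R / N%:R ^+ m) / ln (4 / eps))%:E
     <= D_S k eps d m)%E
   /\ (D_S k eps d m <= D_A k eps d m)%E)
  /\
  (let N := nat_ceil (Num.sqrt d%:R / eps) in
   (D_A k eps d m
     <= (d%:R + 1 / 2 *
          (ln ((max_patch_free R k m N)%:R / N%:R ^+ m) / ln N%:R))%:E)%E).
Proof.
rewrite -(subnKC hmd) in hd hk1 *; move: (d - m)%N => e in hd hk1 *.
split=> N; [split|].
- have x0 : 0 < 1 / (8 * eps) by rewrite divr_gt0 // mulr_gt0.
  have x1 : 1 < 1 / (8 * eps) by rewrite ltr_pdivlMr ?mulr_gt0 //; lra.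
  have N1 : (1 < N)%N by rewrite -(ltr_nat R) (lt_le_trans x1) // nat_ceil_ge.
  have N0 : 0 < N%:R :> R by rewrite ltr0n ltnW.
  have r0 : 0 < (max_patch_free R k m N)%:R :> R.
    by rewrite ltr0n; apply: max_patch_free_gt0 => //; exact: ltnW.
  apply: le_trans (@D_S_ge R k eps m e N _ _ _ _ _ _) => //; last 2 first.
  + exact: ltnW.
  + exact/ltW/nat_ceilB1_lt.
  have L0 : 0 < ln (4 / eps) by rewrite ln_gt0 // ltr_pdivlMr //; lra.
  rewrite lee_fin ler_pdivlMr // mulrDl divfK ?gt_eqF // -mulrA mulrBl mul1r divfK ?gt_eqF //.
  rewrite -ln_div ?posrE ?divr_gt0 //.
  (* This is where 32 comes from: d (ln (4/eps) - ln 32) = d ln (1/(8 eps)) <= d ln N. *)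
  have -> : 4 / eps / 32 = 1 / (8 * eps) by field; rewrite gt_eqF.
  have hln : ln (1 / (8 * eps)) <= ln N%:R by rewrite ler_ln ?posrE // nat_ceil_ge.
  move: hln; set X := ln (1 / _) => hln.
  rewrite ln_div ?posrE ?exprn_gt0 // lnM ?posrE ?exprn_gt0 // !lnXn //.
  rewrite -[_ *+ m]mulr_natl -[_ *+ e]mulr_natl.
  have : (m + e)%:R * X <= (m + e)%:R * ln N%:R by rewrite ler_wpM2l ?ler0n.
  by rewrite natrD; lra.
- by apply: D_S_le_D_A; exact: leq_addr.
- have s1 : 1 <= Num.sqrt (m + e)%:R :> R.
    by rewrite -[leLHS]sqrtr1 ler_wsqrtr // ler1n.
  have x0 : 0 < Num.sqrt (m + e)%:R / eps by rewrite divr_gt0 // (lt_le_trans _ s1).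
  have hN : Num.sqrt (m + e)%:R <= eps * N%:R.
    by rewrite mulrC -ler_pdivrMr // nat_ceil_ge.
  have N1 : (1 < N)%N.
    rewrite -(ltr_nat R); apply: lt_le_trans (nat_ceil_ge x0).
    by rewrite ltr_pdivlMr // (lt_le_trans _ s1) //; lra.
  have N0 : 0 < N%:R :> R by rewrite ltr0n ltnW.
  have r0 : 0 < (max_patch_free R k m N)%:R :> R.
    by rewrite ltr0n; apply: max_patch_free_gt0 => //; exact: ltnW.
  have L0 : 0 < ln N%:R :> R by rewrite ln_gt0 // ltr1n.
  apply: le_trans (D_A_le _ _ N1 hN) _ => //.
  rewrite lee_fin le_eqVlt; apply/orP; left; apply/eqP.
  (* The factor 1/2 arises because each side is cut into N^2 parts: with d = m + e, ln (r N^(2d-m))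
     / (2 ln N) = d + 1/2 ln (r / N^m) / ln N, where r is the maximal size of a patch-free set. *)
  rewrite natrM natrX ln_div ?posrE ?exprn_gt0 // lnM ?posrE ?exprn_gt0 // !lnXn //.
  rewrite -[_ *+ m]mulr_natl -[_ *+ (m + e + e)]mulr_natl -[_ *+ 2]mulr_natl !natrD.
  by field; rewrite gt_eqF.
Qed.
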